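(* The maximum value of the renormalized area $\mathcal{A}_R(M_c)$ among the family of catenoids $\{M_c\}$, $c>0$, in $\mathbb{H}^3$ is attained at the catenoid with maximum height $\Psi_1(c)$ among the family.
   Context: Hyperbolic space is the hyperboloid $\mathbb{H}^{3}=\{(x_1,x_2,x_3,z)\in\mathbb{R}^{4}: x_1^2+x_2^2+x_3^2-z^2=-1,\ z>0\}$ with the metric induced by $dx_1^2+dx_2^2+dx_3^2-dz^2$, identified with the unit (Poincaré) ball via $(x_1,x_2,x_3,z)\mapsto\frac{1}{1+z}(x_1,x_2,x_3)$. Catenoids. Rotational surfaces are those invariant under $O(2)$ acting on $(x_1,x_2)$; non-totally geodesic rotational minimal surfaces are called catenoids and form a one-parameter family $\{M_c\}_{c>0}$ described as follows. Let $\alpha=(c^2+\sqrt{c^4+4})/2$ be the positive root of $-u^2+c^2u+1$, let $u(s)=\frac{2}{\sqrt{c^4+4}\cosh(2s)-c^2}$, which is the non-constant smooth solution of $(u')^2=4u^2(-u^2+c^2u+1)$ with $u(0)=\alpha$, and let $v(s)=-c\int_0^s\frac{u^{3/2}}{1+c^2u}\,d\sigma$. Then $M_c$ is the surface parameterized by $$X_c(s,\theta)=\frac{1}{c\sqrt{u}}\left(\cos\theta,\sin\theta,\sqrt{1+c^2u}\,\sinh v(s),\sqrt{1+c^2u}\,\cosh v(s)\right),\quad s\in\mathbb{R},\ \theta\in\mathbb{R}/2\pi\mathbb{Z}.$$ Height. The height $\Psi_1(c)$ of $M_c$ is the maximum Euclidean distance, in the Poincaré ball model, from (the closure of) its generating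 curve $\{\theta=0\}$ to $\{x_3=0\}$, equivalently half of the Euclidean distance between the two boundary circles of $M_c$ at infinity; it equals $$\Psi_1(c)=\tanh\left(\frac{c}{2}\int_0^\alpha\frac{u}{(c^2u+1)\sqrt{u(-u^2+c^2u+1)}}\,du\right).$$ Renormalized area. For a surface $M\subset\mathbb{H}^{3}$ the renormalized area $\mathcal{A}_R(M)$ is the constant term in the expansion, in powers of $\epsilon>0$ as $\epsilon\to0^+$, of the area of the truncated surface $M_\epsilon=M\cap\{z\le 1/\epsilon\}$. *)

(* Defs.v *)
From Stdlib Require Import Reals.
From Coquelicot Require Import Coquelicot.
Local Open Scope R_scope.

(** * Points and distances *)

Definition R3 : Type := (R * R * R)%type.
Definition R4 : Type := (R * R * R * R)%type.

(* [R4] is Minkowski space, with coordinates (x1, x2, x3, z). *)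
Definition px1 (p : R4) : R := fst (fst (fst p)).
Definition px2 (p : R4) : R := snd (fst (fst p)).
Definition px3 (p : R4) : R := snd (fst p).
Definition pz  (p : R4) : R := snd p.

Definition lorentz (p q : R4) : R :=
  px1 p * px1 q + px2 p * px2 q + px3 p * px3 q - pz p * pz q.

Definition poincare (p : R4) : R3 :=
  (px1 p / (1 + pz p), px2 p / (1 + pz p), px3 p / (1 + pz p)).

Definition edist (p q : R3) : R :=
  sqrt ((fst (fst p) - fst (fst q)) ^ 2
        + (snd (fst p) - snd (fst q)) ^ 2
        + (snd p - snd q) ^ 2).

Definition edist_to (S : R3 -> Prop) (p : R3) : R :=
  real (Glb_Rbar (fun d => exists q : R3, S q /\ d = edist p q)).

Definition eclosure (S : R3 -> Prop) (p : R3) : Prop :=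
  forall e : R, 0 < e -> exists q : R3, S q /\ edist p q < e.

(** * Area of a parameterized spacelike surface [X s t], with [s] in R and
      [t] in R / 2 PI Z *)

Definition curve_deriv (g : R -> R4) (t : R) : R4 :=
  (Derive (fun r => px1 (g r)) t, Derive (fun r => px2 (g r)) t,
   Derive (fun r => px3 (g r)) t, Derive (fun r => pz (g r)) t).

Definition area_element (X : R -> R -> R4) (s t : R) : R :=
  let Xs := curve_deriv (fun r => X r t) s in
  let Xt := curve_deriv (fun r => X s r) t in
  sqrt (lorentz Xs Xs * lorentz Xt Xt - lorentz Xs Xt ^ 2).

(* The integrand vanishes outside the part of the parameter domain that is
   mapped into {z <= 1/eps}. *)
Definition truncated_area (X : R -> R -> R4) (eps : R) : R :=
  RInt (fun t =>
    RInt_gen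
      (fun s => if Rle_dec (pz (X s t)) (1 / eps)
                then area_element X s t else 0)
      (Rbar_locally m_infty) (Rbar_locally p_infty)) 0 (2 * PI).

(* [A] is the constant term of an expansion
     area = a_N / eps^N + ... + a_1 / eps + A + o(1)   as eps -> 0+. *)
Definition is_renormalized_area (X : R -> R -> R4) (A : R) : Prop :=
  exists (N : nat) (a : nat -> R),
    filterlim
      (fun eps => truncated_area X eps
                  - sum_n_m (fun k => a k / eps ^ k) 1 N)
      (at_right 0) (locally A).

(* Coquelicot's [iota] is definite description: this is the number
   characterized by [is_renormalized_area] whenever there is exactly one. *)
Definition renormalized_area (X : R -> R -> R4) : R :=
  iota (is_renormalized_area X).

(** * The catenoids *)

Definition cat_u (c s : R) : R :=
  2 / (sqrt (c ^ 4 + 4) * cosh (2 * s) - c ^ 2).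

Definition cat_v (c s : R) : R :=
  - c * RInt (fun r => Rpower (cat_u c r) (3 / 2) / (1 + c ^ 2 * cat_u c r))
             0 s.

Definition catenoid (c s t : R) : R4 :=
  let m := 1 / (c * sqrt (cat_u c s)) in
  let w := sqrt (1 + c ^ 2 * cat_u c s) in
  (m * cos t, m * sin t,
   m * (w * sinh (cat_v c s)), m * (w * cosh (cat_v c s))).

Definition generating_curve (c : R) (p : R3) : Prop :=
  exists s : R, p = poincare (catenoid c s 0).

(* The closure is compact, so this supremum is a maximum. *)
Definition height (c : R) : R :=
  real (Lub_Rbar (fun h => exists p : R3,
    eclosure (generating_curve c) p
    /\ h = edist_to (fun q => snd q = 0) p)).

(* Main.v *)
Require Import Defs.
From Stdlib Require Import Reals Lra Lia.
From Coquelicot Require Import Coquelicot.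
Local Open Scope R_scope.

(** Put [k = 2 / c ^ 2].  In terms of arc length [s] on the generating curve,
    the distance [r] to the axis of rotation satisfies
    [cosh (2 r) = sqrt (1 + k ^ 2) * cosh (2 s)], and the catenoid is
    [(sinh r cos t, sinh r sin t, - cosh r sinh a, cosh r cosh a)], where the
    translation [a] along the axis has the derivative
    [k / (2 sinh r (cosh r) ^ 2)]: the flux of the surface in the direction of
    the axis is constant.  Two functions of [k] matter.

    - The total translation [halfsep k = lim a].  The curve lies at Euclidean
      height at most [tanh (halfsep k)] and approaches this value, so
      [height c = tanh (halfsep k)] ([height_catenoid]).
    - The number [limit_excess k], the limit of
      [int_0^S sinh r ds - sinh r(S)].  The area below the level [z(S)] is
      [4 PI int_0^S sinh r ds], and
      [z(S) / cosh (halfsep k) - sinh r(S)] tends to 0, so the renormalized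
      area is [4 PI limit_excess k] ([renormalized_area_catenoid]); constant
      terms are unique because a polynomial without constant term that
      converges at infinity vanishes ([renormalized_unique]).

    The first variation of area links the two:
    [d limit_excess = (k / 2) d halfsep], the factor [k / 2] being the flux per
    unit of the rotation angle, that is the momentum conjugate to the
    translation.  Hence [limit_excess] increases
    where [halfsep] does ([limit_excess_mono]), and it suffices to show that
    [halfsep] increases strictly up to some [k0] and decreases strictly after
    it.

    For this, parameterize the curve by the angle [w] with
    [tan w = sqrt (1 + k ^ 2) * sinh (2 s) / k].  Then
    [halfsep k] is [/ sqrt 2] times the integral over the fixed interval
    [[0, PI / 2]] of [phi k (cos w)], a function of [k / cos w] alone.  In the
    variables [ln k] and [- ln (cos w)] this is a convolution of a log-concave
    function ([phi_log_concave]) with a decreasing weight on the half-line, and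
    such a convolution is unimodal.  Concretely, an integration by parts shows
    that the derivative of [halfsep], up to an explicit positive factor, is
    strictly decreasing in [k] ([slope_ratio_decr]); it is positive at
    [k = 1 / 10] and negative at [k = 2]. *)

(** * Generalities *)

Lemma continuity_2d_pt_continuous (f : R -> R -> R) (x y : R) :
  continuity_2d_pt f x y -> continuous (f x) y.
Proof.
intros H; apply continuity_pt_filterlim; intros e He.
destruct (H (mkposreal e He)) as [d Hd].
exists d; split; [apply cond_pos|].
intros z [_ Hz]; apply Hd; [|exact Hz].
unfold Rminus; rewrite Rplus_opp_r, Rabs_R0; apply cond_pos.
Qed.

Lemma locally_gt_0 (k : R) : 0 < k -> locally k (fun z => 0 < z).
Proof. intros Hk; apply (open_gt 0 k Hk). Qed.

Lemma RInt_scal_R (f : R -> R) (a b c : R) :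
  ex_RInt f a b -> RInt (fun x => c * f x) a b = c * RInt f a b.
Proof. apply (RInt_scal f). Qed.

Lemma RInt_ge_const (f : R -> R) (a b c : R) :
  a <= b -> ex_RInt f a b -> (forall x, a < x < b -> c <= f x) ->
  c * (b - a) <= RInt f a b.
Proof.
intros Hab Hf Hc.
apply Rle_trans with (RInt (fun _ => c) a b).
- rewrite RInt_const; apply Req_le, Rmult_comm.
- apply RInt_le; [exact Hab|apply ex_RInt_const|exact Hf|exact Hc].
Qed.

Lemma RInt_even (f : R -> R) (s : R) :
  (forall x, f (- x) = f x) -> (forall a b, ex_RInt f a b) ->
  RInt f 0 (- s) = - RInt f 0 s.
Proof.
intros He Hf.
assert (A := @RInt_correct R_CompleteNormedModule f (- 0) (- s) (Hf _ _)).
apply is_RInt_comp_opp in A.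
apply (is_RInt_ext _ (fun x => opp (f x))) in A; [|intros; rewrite He; reflexivity].
apply (@is_RInt_unique R_CompleteNormedModule) in A.
rewrite Ropp_0 in A; rewrite <- A.
apply (RInt_opp f), Hf.
Qed.

Lemma cos_bounds (w : R) : 0 < w < PI / 2 -> 0 < cos w < 1.
Proof.
intros Hw; split; [apply cos_gt_0; lra|].
rewrite <- cos_0; apply cos_decreasing_1; lra.
Qed.

Lemma sinh_opp (x : R) : sinh (- x) = - sinh x.
Proof. unfold sinh; rewrite Ropp_involutive; field. Qed.

Lemma cosh_opp (x : R) : cosh (- x) = cosh x.
Proof. unfold cosh; rewrite Ropp_involutive; field. Qed.

Lemma cosh_sqr (y : R) : cosh y ^ 2 = 1 + sinh y ^ 2.
Proof.
unfold cosh, sinh.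
assert (H : exp y * exp (- y) = 1)
  by (rewrite <- exp_plus, Rplus_opp_r; apply exp_0).
nra.
Qed.

Lemma cosh_ge_1 (y : R) : 1 <= cosh y.
Proof.
assert (H := cosh_sqr y).
assert (0 < cosh y).
{ unfold cosh; assert (H1 := exp_pos y); assert (H2 := exp_pos (- y)); lra. }
nra.
Qed.

Lemma sinh_ge_0 (x : R) : 0 <= x -> 0 <= sinh x.
Proof.
intros Hx; rewrite <- sinh_0; destruct Hx as [Hx| <-]; [left; apply sinh_lt, Hx|right; reflexivity].
Qed.

Lemma is_derive_sinh (y : R) : is_derive sinh y (cosh y).
Proof. apply is_derive_Reals, derivable_pt_lim_sinh. Qed.

Lemma is_derive_cosh (y : R) : is_derive cosh y (sinh y).
Proof. apply is_derive_Reals, derivable_pt_lim_cosh. Qed.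

Lemma continuous_sinh (x : R) : continuous sinh x.
Proof. apply (ex_derive_continuous sinh); eexists; apply is_derive_sinh. Qed.

Lemma continuous_cosh (x : R) : continuous cosh x.
Proof. apply (ex_derive_continuous cosh); eexists; apply is_derive_cosh. Qed.

Lemma cosh_le (a b : R) : 0 <= a <= b -> cosh a <= cosh b.
Proof.
intros [Ha [Hb| <-]]; [|apply Rle_refl].
destruct (MVT_cor2 cosh sinh a b Hb) as [x [E Hx]];
  [intros; apply derivable_pt_lim_cosh|].
assert (0 <= sinh x) by (apply sinh_ge_0; lra).
nra.
Qed.

Lemma cosh_gap (a b : R) : 0 <= a <= b -> cosh b - cosh a <= cosh b * (b - a).
Proof.
intros [Ha [Hb| <-]]; [|lra].
destruct (MVT_cor2 cosh sinh a b Hb) as [x [E Hx]];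
  [intros; apply derivable_pt_lim_cosh|].
rewrite E; apply Rmult_le_compat_r; [lra|].
apply Rle_trans with (cosh x); [|apply cosh_le; lra].
assert (A := cosh_sqr x); assert (B := cosh_ge_1 x).
nra.
Qed.

Lemma tanh_lt (x y : R) : x < y -> tanh x < tanh y.
Proof.
intros Hxy; unfold tanh.
assert (Cx := cosh_ge_1 x); assert (Cy := cosh_ge_1 y).
apply Rmult_lt_reg_r with (cosh x * cosh y); [nra|].
replace (sinh x / cosh x * (cosh x * cosh y)) with (sinh x * cosh y) by (field; lra).
replace (sinh y / cosh y * (cosh x * cosh y)) with (sinh y * cosh x) by (field; lra).
assert (E : sinh y * cosh x - sinh x * cosh y = sinh (y - x)).
{ unfold sinh, cosh.
  replace (y - x) with (y + - x) by ring.
  replace (- (y + - x)) with (- y + x) by ring.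
  rewrite !exp_plus; field. }
assert (0 < sinh (y - x)) by (rewrite <- sinh_0; apply sinh_lt; lra).
lra.
Qed.

Lemma tanh_le (x y : R) : x <= y -> tanh x <= tanh y.
Proof. intros [H| ->]; [left; apply tanh_lt, H|apply Rle_refl]. Qed.

Lemma exp_double (s : R) : exp (2 * s) = exp s ^ 2.
Proof. replace (2 * s) with (s + s) by ring; rewrite exp_plus; ring. Qed.

Lemma atan_le (y : R) : 0 <= y -> atan y <= y.
Proof.
intros Hy.
destruct (MVT_gen atan 0 y (fun x => / (1 + Rsqr x))) as [c [Hc E]].
- intros; apply is_derive_atan.
- intros; apply derivable_continuous_pt, derivable_pt_atan.
- rewrite atan_0, !Rminus_0_r in E; rewrite E.
  assert (H := Rle_0_sqr c).
  assert (/ (1 + Rsqr c) <= 1) by (rewrite <- Rinv_1; apply Rinv_le_contravar; lra).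
  nra.
Qed.

Lemma PI2_minus_atan (y : R) : 0 < y -> PI / 2 - atan y <= / y.
Proof.
intros Hy; rewrite <- atan_inv by exact Hy.
apply atan_le; left; apply Rinv_0_lt_compat, Hy.
Qed.

Lemma is_lim_arcsinh_p : is_lim arcsinh p_infty p_infty.
Proof.
apply is_lim_spec; intros M; exists (sinh M); intros x Hx.
rewrite <- (arcsinh_sinh M); apply arcsinh_lt, Hx.
Qed.

Lemma is_lim_exp_opp : is_lim (fun s => exp (- s)) p_infty 0.
Proof.
apply (is_lim_comp exp (fun s => - s) p_infty 0 m_infty).
- apply is_lim_exp_m.
- apply (is_lim_opp (fun s => s) p_infty p_infty), is_lim_id.
- exists 0; discriminate.
Qed.

Lemma is_lim_exp_opp_scal (M : R) : is_lim (fun s => M * exp (- s)) p_infty 0.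
Proof.
evar_last; [apply is_lim_scal_l, is_lim_exp_opp|simpl; f_equal; ring].
Qed.

Lemma is_lim_inv_sqrt (A : R) : is_lim (fun Y => A * / sqrt Y) p_infty 0.
Proof.
evar_last.
- apply is_lim_scal_l.
  apply (is_lim_inv sqrt p_infty p_infty); [apply filterlim_sqrt_p|discriminate].
- simpl; f_equal; ring.
Qed.

Lemma is_lim_comp_cont (f g : R -> R) (l : R) :
  continuous f l -> is_lim g p_infty l -> is_lim (fun s => f (g s)) p_infty (f l).
Proof. intros Hf Hg; apply (filterlim_comp _ _ _ g f _ (locally l) _ Hg Hf). Qed.

(** Adding or subtracting [M * exp (- s)] makes [F] monotone in one direction
    or the other, which bounds its oscillation beyond [u] by [M * exp (- u)];
    Cauchy's criterion applies. *)
Lemma ex_lim_exp_decay (F dF : R -> R) (M : R) :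
  (forall s, 0 < s -> is_derive F s (dF s)) ->
  (forall s, 0 < s -> Rabs (dF s) <= M * exp (- s)) ->
  exists l : R, is_lim F p_infty l.
Proof.
intros HF HM.
assert (D : forall u v, 0 < u < v -> Rabs (F v - F u) <= M * exp (- u)).
{ intros u v Huv.
  assert (M0 : 0 <= M).
  { assert (A := HM u ltac:(lra)); assert (B := Rabs_pos (dF u)).
    assert (X := exp_pos (- u)); nra. }
  assert (X : 0 <= M * exp (- v)) by (assert (X := exp_pos (- v)); nra).
  apply Rabs_le; split.
  - destruct (MVT_cor2 (fun s => F s - M * exp (- s)) (fun s => dF s + M * exp (- s)) u v)
      as [c [E Hc]]; [lra| |].
    + intros c Hc; apply is_derive_Reals.
      apply (is_derive_ext (fun s => minus (F s) (M * exp (- s)))); [reflexivity|].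
      replace (dF c + M * exp (- c)) with (minus (dF c) (- M * exp (- c)))
        by (unfold minus, plus, opp; simpl; ring).
      apply (is_derive_minus F (fun s => M * exp (- s))); [apply HF; lra|].
      auto_derive; [exact I|ring].
    + assert (A := HM c ltac:(lra)); apply Rabs_le_between in A.
      assert (0 <= (dF c + M * exp (- c)) * (v - u)) by (apply Rmult_le_pos; lra).
      lra.
  - destruct (MVT_cor2 (fun s => F s + M * exp (- s)) (fun s => dF s - M * exp (- s)) u v)
      as [c [E Hc]]; [lra| |].
    + intros c Hc; apply is_derive_Reals.
      replace (dF c - M * exp (- c)) with (plus (dF c) (- M * exp (- c)))
        by (unfold plus; simpl; ring).
      apply (is_derive_plus F (fun s => M * exp (- s))); [apply HF; lra|].
      auto_derive; [exact I|ring].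
    + assert (A := HM c ltac:(lra)); apply Rabs_le_between in A.
      assert (0 <= - (dF c - M * exp (- c)) * (v - u)) by (apply Rmult_le_pos; lra).
      lra. }
assert (Z := is_lim_exp_opp_scal M).
destruct (proj1 (@filterlim_locally_cauchy _ R_CompleteSpace (Rbar_locally p_infty) _ F))
  as [l Hl].
- intros eps.
  destruct (proj2 (is_lim_spec _ _ _) Z eps) as [N HN].
  exists (fun s => Rmax 0 N < s); split; [exists (Rmax 0 N); tauto|].
  assert (W : forall u v, Rmax 0 N < u -> u <= v -> Rabs (F v - F u) < eps).
  { intros u v Hu Huv.
    assert (0 < u) by (apply Rle_lt_trans with (2 := Hu), Rmax_l).
    assert (HNu : N < u) by (apply Rle_lt_trans with (2 := Hu), Rmax_r).
    apply HN in HNu; rewrite Rminus_0_r in HNu.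
    apply Rabs_lt_between in HNu.
    destruct Huv as [Huv|<-].
    - assert (A := D u v ltac:(lra)); lra.
    - rewrite Rminus_diag, Rabs_R0; apply cond_pos. }
  intros u v Hu Hv.
  destruct (Rle_lt_dec u v) as [H|H].
  + apply (W u v Hu H).
  + apply ball_sym, (W v u Hv); lra.
- exists l; exact Hl.
Qed.

(** * The integrand on the angle interval *)

(** The value of [1 / cosh (2 r)] at the point of the curve whose angle has
    cosine [q]; it depends on [q / k] only. *)
Definition beta (k q : R) : R := q / sqrt (q ^ 2 + k ^ 2).

(** For [0 < k] this vanishes when [q <= 0], by the convention on [sqrt], so
    it is continuous across [q = 0], that is across the end [w = PI / 2] of
    the angle interval. *)
Definition phi (k q : R) : R := sqrt (beta k q * (1 - beta k q)).

(** [k] times the derivative of [phi] in [k] and, where [0 < cos w], also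
    [cot w] times the derivative of [phi k (cos w)] in [w]: both come from
    [phi] being a function of [k / q]. *)
Definition psi (k q : R) : R :=
  phi k q * ((2 * beta k q - 1) * (beta k q + 1) / 2).

Lemma hyp_pos (k q : R) : 0 < k -> 0 < sqrt (q ^ 2 + k ^ 2).
Proof. intros Hk; apply sqrt_lt_R0; nra. Qed.

Lemma beta_lt_1 (k q : R) : 0 < k -> beta k q < 1.
Proof.
intros Hk; unfold beta.
assert (H := hyp_pos k q Hk).
apply Rmult_lt_reg_r with (sqrt (q ^ 2 + k ^ 2)); [exact H|].
unfold Rdiv; rewrite Rmult_assoc, Rinv_l, Rmult_1_r, Rmult_1_l by lra.
destruct (Rle_lt_dec q 0) as [Hq|Hq]; [lra|].
rewrite <- (sqrt_pow2 q) at 1 by lra.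
apply sqrt_lt_1; nra.
Qed.

Lemma beta_gt_0 (k q : R) : 0 < k -> 0 < q -> 0 < beta k q.
Proof. intros Hk Hq; apply Rdiv_lt_0_compat; [exact Hq|apply hyp_pos, Hk]. Qed.

Lemma beta_sqr (k q : R) : 0 < k -> beta k q ^ 2 = q ^ 2 / (q ^ 2 + k ^ 2).
Proof.
intros Hk; unfold beta, Rdiv; rewrite Rpow_mult_distr, pow_inv, pow2_sqrt by nra.
reflexivity.
Qed.

Lemma phi_0_le (k q : R) : 0 < k -> q <= 0 -> phi k q = 0.
Proof.
intros Hk Hq; unfold phi; apply sqrt_neg_0.
assert (H := beta_lt_1 k q Hk).
assert (beta k q <= 0).
{ unfold beta, Rdiv.
  assert (0 < / sqrt (q ^ 2 + k ^ 2)) by (apply Rinv_0_lt_compat, hyp_pos, Hk).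
  nra. }
nra.
Qed.

Lemma phi_gt_0 (k q : R) : 0 < k -> 0 < q -> 0 < phi k q.
Proof.
intros Hk Hq; apply sqrt_lt_R0.
assert (H := beta_lt_1 k q Hk); assert (H' := beta_gt_0 k q Hk Hq); nra.
Qed.

Lemma phi_le_half (k q : R) : phi k q <= 1 / 2.
Proof.
unfold phi; rewrite <- (sqrt_pow2 (1 / 2)) by lra.
apply sqrt_le_1_alt; assert (H := pow2_ge_0 (beta k q - 1 / 2)); nra.
Qed.

Lemma psi_bounds (k q : R) : 0 < k -> -1 / 4 <= psi k q <= 1 / 2.
Proof.
intros Hk; unfold psi.
destruct (Rle_lt_dec q 0) as [Hq|Hq].
{ rewrite phi_0_le by lra; lra. }
assert (H1 := beta_lt_1 k q Hk); assert (H2 := beta_gt_0 k q Hk Hq).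
assert (H3 := phi_gt_0 k q Hk Hq); assert (H4 := phi_le_half k q).
assert (-1 / 2 <= (2 * beta k q - 1) * (beta k q + 1) / 2 <= 1) by nra.
nra.
Qed.

(** For [q <= 0] the function is locally zero; at [q > 0] the argument of
    the square root is positive. *)
Lemma is_derive_phi_k (k q : R) :
  0 < k -> is_derive (fun z => phi z q) k (psi k q / k).
Proof.
intros Hk; destruct (Rle_lt_dec q 0) as [Hq|Hq].
- unfold psi; rewrite phi_0_le, Rmult_0_l by lra.
  unfold Rdiv; rewrite Rmult_0_l.
  apply is_derive_ext_loc with (fun _ => 0); [|apply @is_derive_const].
  exists (mkposreal k Hk); intros z Hz; symmetry; apply phi_0_le; [|exact Hq].
  apply Rabs_lt_between' in Hz; simpl in Hz; lra.
- assert (H1 := beta_lt_1 k q Hk); assert (H2 := beta_gt_0 k q Hk Hq).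
  assert (H0 := hyp_pos k q Hk).
  assert (Db : is_derive (fun z => beta z q) k
                 (- (beta k q * (1 - beta k q ^ 2)) / k)).
  { unfold beta; auto_derive.
    { split; [nra|split; [|exact I]]; simpl in H0; lra. }
    replace (q * (q * 1) + k * (k * 1)) with (q ^ 2 + k ^ 2) by ring.
    unfold Rdiv.
    rewrite Rpow_mult_distr, pow_inv, pow2_sqrt by nra.
    set (Q := sqrt (q ^ 2 + k ^ 2)) in *.
    replace (1 - q ^ 2 * / (q ^ 2 + k ^ 2)) with (k ^ 2 / (q ^ 2 + k ^ 2))
      by (field; nra).
    replace (q ^ 2 + k ^ 2) with (Q ^ 2) by (unfold Q; rewrite pow2_sqrt; nra).
    field; lra. }
  assert (H3 := phi_gt_0 k q Hk Hq).
  assert (Hs : phi k q * phi k q = beta k q * (1 - beta k q))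
    by (apply sqrt_sqrt; nra).
  replace (psi k q / k) with
    ((- (beta k q * (1 - beta k q ^ 2)) / k) * (1 - 2 * beta k q)
       * / (2 * phi k q)).
  2:{ unfold psi; apply Rmult_eq_reg_r with (2 * phi k q * k); [|nra].
      transitivity (- (beta k q * (1 - beta k q ^ 2)) * (1 - 2 * beta k q)).
      - field; split; lra.
      - transitivity ((phi k q * phi k q) * (2 * beta k q - 1) * (beta k q + 1)).
        + rewrite Hs; ring.
        + field; lra. }
  unfold phi at 1.
  evar_last.
  + apply (is_derive_comp (fun y => sqrt (y * (1 - y))) (fun z => beta z q)).
    * auto_derive; [|reflexivity]. nra.
    * exact Db.
  + unfold scal; simpl; unfold mult; simpl.
    replace (sqrt (beta k q * (1 + - beta k q))) with (phi k q)
      by reflexivity.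
    field; lra.
Qed.

Lemma is_derive_phi_w (k w : R) :
  0 < k -> 0 < cos w ->
  is_derive (fun v => phi k (cos v)) w (tan w * psi k (cos w)).
Proof.
intros Hk Hq; unfold tan.
assert (H1 := beta_lt_1 k (cos w) Hk).
assert (H2 := beta_gt_0 k (cos w) Hk Hq).
assert (H0 := hyp_pos k (cos w) Hk).
assert (Db : is_derive (fun v => beta k (cos v)) w
               (- (sin w / cos w) * (beta k (cos w) * (1 - beta k (cos w) ^ 2)))).
{ unfold beta; auto_derive.
  { split; [nra|split; [|exact I]]; simpl in H0; lra. }
  set (q := cos w) in *.
  replace (q * (q * 1) + k * (k * 1)) with (q ^ 2 + k ^ 2) by ring.
  unfold Rdiv.
  rewrite Rpow_mult_distr, pow_inv, pow2_sqrt by nra.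
  set (Q := sqrt (q ^ 2 + k ^ 2)) in *.
  replace (1 - q ^ 2 * / (q ^ 2 + k ^ 2)) with (k ^ 2 / (q ^ 2 + k ^ 2))
    by (field; nra).
  assert (HQ : q ^ 2 + k ^ 2 = Q ^ 2) by (unfold Q; rewrite pow2_sqrt; nra).
  rewrite HQ.
  replace (k ^ 2) with (Q ^ 2 - q ^ 2) by lra.
  field; lra. }
assert (H3 := phi_gt_0 k (cos w) Hk Hq).
assert (Hs : phi k (cos w) * phi k (cos w) = beta k (cos w) * (1 - beta k (cos w)))
  by (apply sqrt_sqrt; nra).
evar_last.
- apply (is_derive_comp (fun y => sqrt (y * (1 - y))) (fun v => beta k (cos v))).
  + auto_derive; [|reflexivity]. nra.
  + exact Db.
- unfold scal; simpl; unfold mult; simpl.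
  fold (phi k (cos w)).
  replace (sqrt (beta k (cos w) * (1 + - beta k (cos w)))) with (phi k (cos w))
    by reflexivity.
  unfold psi; apply Rmult_eq_reg_r with (2 * phi k (cos w) * cos w); [|nra].
  transitivity (- sin w * (beta k (cos w) * (1 - beta k (cos w) ^ 2)) * (1 - 2 * beta k (cos w))).
  + field; split; lra.
  + transitivity (sin w * (phi k (cos w) * phi k (cos w)) * (2 * beta k (cos w) - 1) * (beta k (cos w) + 1)).
    * rewrite Hs; ring.
    * field; lra.
Qed.

Lemma continuity_2d_beta (k w : R) :
  0 < k -> continuity_2d_pt (fun z v => beta z (cos v)) k w.
Proof.
intros Hk; unfold beta, Rdiv.
assert (C : continuity_2d_pt (fun _ v => cos v) k w).
{ apply (continuity_1d_2d_pt_comp cos (fun _ v => v));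
    [apply continuity_cos|apply continuity_2d_pt_id2]. }
apply continuity_2d_pt_mult; [exact C|].
apply continuity_2d_pt_inv.
- apply (continuity_1d_2d_pt_comp sqrt).
  + apply continuity_pt_filterlim, continuous_sqrt.
  + apply (continuity_2d_pt_ext (fun z v => cos v * cos v + z * z));
      [intros; ring|].
    apply continuity_2d_pt_plus; apply continuity_2d_pt_mult; try exact C;
      apply continuity_2d_pt_id1.
- apply Rgt_not_eq, hyp_pos, Hk.
Qed.

Lemma continuity_2d_phi (k w : R) :
  0 < k -> continuity_2d_pt (fun z v => phi z (cos v)) k w.
Proof.
intros Hk; unfold phi.
apply (continuity_1d_2d_pt_comp sqrt).
- apply continuity_pt_filterlim, continuous_sqrt.
- apply continuity_2d_pt_mult; [|apply continuity_2d_pt_minus];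
    try apply continuity_2d_pt_const; apply continuity_2d_beta, Hk.
Qed.

Lemma continuity_2d_psi (k w : R) :
  0 < k -> continuity_2d_pt (fun z v => psi z (cos v)) k w.
Proof.
intros Hk; unfold psi, Rdiv.
repeat first [apply continuity_2d_phi, Hk | apply continuity_2d_beta, Hk
             | apply continuity_2d_pt_const | apply continuity_2d_pt_mult
             | apply continuity_2d_pt_minus | apply continuity_2d_pt_plus].
Qed.

Lemma continuous_phi (k w : R) : 0 < k -> continuous (fun v => phi k (cos v)) w.
Proof.
intros Hk; apply (continuity_2d_pt_continuous (fun z v => phi z (cos v))).
apply continuity_2d_phi, Hk.
Qed.

Lemma continuous_psi (k w : R) : 0 < k -> continuous (fun v => psi k (cos v)) w.
Proof.
intros Hk; apply (continuity_2d_pt_continuous (fun z v => psi z (cos v))).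
apply continuity_2d_psi, Hk.
Qed.

Lemma ex_RInt_phi (k a b : R) : 0 < k -> ex_RInt (fun w => phi k (cos w)) a b.
Proof. intros Hk; apply (@ex_RInt_continuous R_CompleteNormedModule); intros; apply continuous_phi, Hk. Qed.

Lemma ex_RInt_psi (k a b : R) : 0 < k -> ex_RInt (fun w => psi k (cos w)) a b.
Proof. intros Hk; apply (@ex_RInt_continuous R_CompleteNormedModule); intros; apply continuous_psi, Hk. Qed.

(** The weight [h] is 1 for the translation and [/ cos w ^ 2] for the
    area. *)
Lemma is_derive_RInt_phi (h : R -> R) (b k : R) :
  0 < k -> (forall w, Rmin 0 b <= w <= Rmax 0 b -> continuous h w) ->
  is_derive (fun z => RInt (fun w => phi z (cos w) * h w) 0 b) k
    (RInt (fun w => psi k (cos w) / k * h w) 0 b).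
Proof.
intros Hk Hh.
assert (D : forall z w, 0 < z ->
          is_derive (fun u => phi u (cos w) * h w) z (psi z (cos w) / z * h w)).
{ intros z w Hz.
  apply (is_derive_scal_l (fun u => phi u (cos w)) z (psi z (cos w) / z) (h w)).
  apply is_derive_phi_k, Hz. }
evar_last.
- apply (is_derive_RInt_param (fun z w => phi z (cos w) * h w)).
  + apply filter_imp with (2 := locally_gt_0 k Hk).
    intros z Hz w _; eexists; apply D, Hz.
  + intros w Hw.
    apply continuity_2d_pt_ext_loc with (fun z v => psi z (cos v) / z * h v).
    * exists (mkposreal k Hk); intros u v Hu _; symmetry.
      apply is_derive_unique, D.
      apply Rabs_lt_between' in Hu; simpl in Hu; lra.
    * apply continuity_2d_pt_mult.
      -- apply continuity_2d_pt_mult; [apply continuity_2d_psi, Hk|].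
         apply continuity_2d_pt_inv; [apply continuity_2d_pt_id1|lra].
      -- apply (continuity_1d_2d_pt_comp h (fun _ v => v));
           [|apply continuity_2d_pt_id2].
         apply continuity_pt_filterlim, Hh, Hw.
  + apply filter_imp with (2 := locally_gt_0 k Hk).
    intros z Hz; apply (@ex_RInt_continuous R_CompleteNormedModule).
    intros w Hw; apply (continuous_mult (fun w => phi z (cos w)) h);
      [apply continuous_phi, Hz|apply Hh, Hw].
- apply RInt_ext; intros w _; apply is_derive_unique, D, Hk.
Qed.

(** * Unimodality of the total translation *)

(** Half the hyperbolic distance, measured along the axis, between the two
    ends of the catenoid. *)
Definition halfsep (k : R) : R := / sqrt 2 * RInt (fun w => phi k (cos w)) 0 (PI / 2).

(** [sqrt 2 * k] times the derivative of [halfsep]. *)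
Definition slope (k : R) : R := RInt (fun w => psi k (cos w)) 0 (PI / 2).

Lemma is_derive_halfsep (k : R) :
  0 < k -> is_derive halfsep k (/ sqrt 2 * (slope k / k)).
Proof.
intros Hk; unfold halfsep; apply is_derive_scal.
apply is_derive_ext with
  (fun z => RInt (fun w => phi z (cos w) * 1) 0 (PI / 2)).
{ intros z; apply RInt_ext; intros; apply Rmult_1_r. }
evar_last.
- apply (is_derive_RInt_phi (fun _ => 1)); [exact Hk|].
  intros; apply continuous_const.
- unfold slope.
  transitivity (RInt (fun w => / k * psi k (cos w)) 0 (PI / 2)).
  + apply RInt_ext; intros; simpl; field; lra.
  + rewrite RInt_scal_R by (apply ex_RInt_psi, Hk).
    field; lra.
Qed.

Lemma phi_sqr (k q : R) : 0 < k -> 0 < q ->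
  phi k q ^ 2 * (sqrt (q ^ 2 + k ^ 2) ^ 2 * (sqrt (q ^ 2 + k ^ 2) + q)) = q * k ^ 2.
Proof.
intros Hk Hq; unfold phi.
assert (H1 := beta_lt_1 k q Hk); assert (H2 := beta_gt_0 k q Hk Hq).
rewrite pow2_sqrt by nra.
assert (H0 := hyp_pos k q Hk).
unfold beta; set (Q := sqrt (q ^ 2 + k ^ 2)) in *.
assert (HQ : Q ^ 2 = q ^ 2 + k ^ 2) by (unfold Q; rewrite pow2_sqrt; nra).
replace (k ^ 2) with (Q ^ 2 - q ^ 2) by lra.
field; lra.
Qed.

(** Log-concavity of [phi] in the variable [ln k - ln q], in the form that
    [phi k q / phi k 1] decreases in [k].  With [Q = sqrt (q ^ 2 + k ^ 2)] one
    has [phi k q ^ 2 = q * k ^ 2 / (Q ^ 2 * (Q + q))], so the claim splits into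
    the comparisons [L1] and [L3] of the two factors of the denominators. *)
Lemma phi_log_concave (k1 k2 q : R) :
  0 < k1 < k2 -> 0 < q < 1 -> phi k2 q * phi k1 1 < phi k1 q * phi k2 1.
Proof.
intros [H1 H2] [Hq Hq1].
assert (Hk2 : 0 < k2) by lra.
assert (A1 := phi_gt_0 k1 q H1 Hq); assert (A2 := phi_gt_0 k2 q Hk2 Hq).
assert (A3 := phi_gt_0 k1 1 H1 Rlt_0_1); assert (A4 := phi_gt_0 k2 1 Hk2 Rlt_0_1).
assert (E1 := phi_sqr k1 q H1 Hq); assert (E2 := phi_sqr k2 q Hk2 Hq).
assert (E3 := phi_sqr k1 1 H1 Rlt_0_1); assert (E4 := phi_sqr k2 1 Hk2 Rlt_0_1).
assert (P1 := hyp_pos k1 q H1); assert (P2 := hyp_pos k2 q Hk2).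
assert (P3 := hyp_pos k1 1 H1); assert (P4 := hyp_pos k2 1 Hk2).
assert (S1 : sqrt (q ^ 2 + k1 ^ 2) ^ 2 = q ^ 2 + k1 ^ 2) by (apply pow2_sqrt; nra).
assert (S2 : sqrt (q ^ 2 + k2 ^ 2) ^ 2 = q ^ 2 + k2 ^ 2) by (apply pow2_sqrt; nra).
assert (S3 : sqrt (1 ^ 2 + k1 ^ 2) ^ 2 = 1 + k1 ^ 2) by (rewrite pow2_sqrt; nra).
assert (S4 : sqrt (1 ^ 2 + k2 ^ 2) ^ 2 = 1 + k2 ^ 2) by (rewrite pow2_sqrt; nra).
set (Q1 := sqrt (q ^ 2 + k1 ^ 2)) in *; set (Q2 := sqrt (q ^ 2 + k2 ^ 2)) in *.
set (T1 := sqrt (1 ^ 2 + k1 ^ 2)) in *; set (T2 := sqrt (1 ^ 2 + k2 ^ 2)) in *.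
assert (Hd : 0 < k2 ^ 2 - k1 ^ 2) by nra.
assert (L1 : Q1 * T2 < Q2 * T1).
{ apply Rsqr_incrst_0; [|nra|nra].
  unfold Rsqr.
  replace (Q1 * T2 * (Q1 * T2)) with (Q1 ^ 2 * T2 ^ 2) by ring.
  replace (Q2 * T1 * (Q2 * T1)) with (Q2 ^ 2 * T1 ^ 2) by ring.
  rewrite S1, S2, S3, S4.
  assert (0 < (1 - q ^ 2) * (k2 ^ 2 - k1 ^ 2)) by (apply Rmult_lt_0_compat; nra).
  nra. }
assert (L2 : q * (T2 - T1) <= Q2 - Q1).
{ assert (U1 : Q1 <= T1) by (apply sqrt_le_1_alt; nra).
  assert (U2 : Q2 <= T2) by (apply sqrt_le_1_alt; nra).
  assert (U3 : T1 < T2) by (apply sqrt_lt_1_alt; nra).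
  apply Rmult_le_reg_r with (Q1 + Q2); [lra|].
  replace ((Q2 - Q1) * (Q1 + Q2)) with ((T2 - T1) * (T1 + T2)) by nra.
  assert (0 <= T1 + T2 - q * (Q1 + Q2)) by nra.
  nra. }
assert (L3 : (Q1 + q) * (T2 + 1) <= (Q2 + q) * (T1 + 1)) by nra.
assert (L4 : (Q1 ^ 2 * (Q1 + q)) * (T2 ^ 2 * (T2 + 1))
             < (Q2 ^ 2 * (Q2 + q)) * (T1 ^ 2 * (T1 + 1))).
{ replace ((Q1 ^ 2 * (Q1 + q)) * (T2 ^ 2 * (T2 + 1)))
    with ((Q1 * T2) ^ 2 * ((Q1 + q) * (T2 + 1))) by ring.
  replace ((Q2 ^ 2 * (Q2 + q)) * (T1 ^ 2 * (T1 + 1)))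
    with ((Q2 * T1) ^ 2 * ((Q2 + q) * (T1 + 1))) by ring.
  apply Rlt_le_trans with ((Q2 * T1) ^ 2 * ((Q1 + q) * (T2 + 1))).
  - apply Rmult_lt_compat_r; [nra|]. assert (0 < Q1 * T2) by nra. nra.
  - apply Rmult_le_compat_l; [apply pow2_ge_0|exact L3]. }
assert (X1 : 0 < Q1 ^ 2 * (Q1 + q)) by (apply Rmult_lt_0_compat; nra).
assert (X2 : 0 < Q2 ^ 2 * (Q2 + q)) by (apply Rmult_lt_0_compat; nra).
assert (X3 : 0 < T1 ^ 2 * (T1 + 1)) by (apply Rmult_lt_0_compat; nra).
assert (X4 : 0 < T2 ^ 2 * (T2 + 1)) by (apply Rmult_lt_0_compat; nra).
set (a1 := Q1 ^ 2 * (Q1 + q)) in *; set (a2 := Q2 ^ 2 * (Q2 + q)) in *.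
set (b1 := T1 ^ 2 * (T1 + 1)) in *; set (b2 := T2 ^ 2 * (T2 + 1)) in *.
apply Rsqr_incrst_0; [|nra|nra].
unfold Rsqr.
replace (phi k2 q * phi k1 1 * (phi k2 q * phi k1 1))
  with (phi k2 q ^ 2 * phi k1 1 ^ 2) by ring.
replace (phi k1 q * phi k2 1 * (phi k1 q * phi k2 1))
  with (phi k1 q ^ 2 * phi k2 1 ^ 2) by ring.
replace (phi k2 q ^ 2) with (q * k2 ^ 2 / a2) by (rewrite <- E2; field; lra).
replace (phi k1 q ^ 2) with (q * k1 ^ 2 / a1) by (rewrite <- E1; field; lra).
replace (phi k1 1 ^ 2) with (1 * k1 ^ 2 / b1) by (rewrite <- E3; field; lra).
replace (phi k2 1 ^ 2) with (1 * k2 ^ 2 / b2) by (rewrite <- E4; field; lra).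
replace (q * k2 ^ 2 / a2 * (1 * k1 ^ 2 / b1))
  with (q * k1 ^ 2 * k2 ^ 2 * / (a2 * b1)) by (field; lra).
replace (q * k1 ^ 2 / a1 * (1 * k2 ^ 2 / b2))
  with (q * k1 ^ 2 * k2 ^ 2 * / (a1 * b2)) by (field; lra).
apply Rmult_lt_compat_l.
- apply Rmult_lt_0_compat; [apply Rmult_lt_0_compat|]; nra.
- apply Rinv_lt_contravar; [|exact L4].
  apply Rmult_lt_0_compat; apply Rmult_lt_0_compat; assumption.
Qed.

(** The core of unimodality.  Let [g] be the difference of the normalized
    functions [phi k (cos w) / phi k 1] for [k1] and [k2], and [D] that of the
    normalized [psi].  Since [g' = tan w * D], integrating [D = cot w * g'] by
    parts gives the integral of [g / sin w ^ 2], and [g > 0] by log-concavity.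
    The function [J] is the integral of [D] minus the boundary term: it
    increases, tends to 0 at 0, and at [PI / 2] equals the difference of
    the two sides. *)
Lemma slope_ratio_decr (k1 k2 : R) :
  0 < k1 < k2 -> slope k2 / phi k2 1 < slope k1 / phi k1 1.
Proof.
intros [H1 H2].
assert (Hk2 : 0 < k2) by lra.
assert (A3 := phi_gt_0 k1 1 H1 Rlt_0_1); assert (A4 := phi_gt_0 k2 1 Hk2 Rlt_0_1).
assert (HPI := PI2_3_2).
set (g := fun w => phi k1 (cos w) / phi k1 1 - phi k2 (cos w) / phi k2 1).
set (D := fun w => psi k1 (cos w) / phi k1 1 - psi k2 (cos w) / phi k2 1).
assert (g_pos : forall w, 0 < w < PI / 2 -> 0 < g w).
{ intros w Hw; unfold g.
  assert (L := phi_log_concave k1 k2 (cos w) (conj H1 H2) (cos_bounds w Hw)).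
  apply Rmult_lt_reg_r with (phi k1 1 * phi k2 1); [nra|].
  replace ((phi k1 (cos w) / phi k1 1 - phi k2 (cos w) / phi k2 1)
           * (phi k1 1 * phi k2 1))
    with (phi k1 (cos w) * phi k2 1 - phi k2 (cos w) * phi k1 1)
    by (field; lra).
  lra. }
assert (g_0 : g 0 = 0) by (unfold g; rewrite cos_0; field; lra).
assert (g_end : g (PI / 2) = 0)
  by (unfold g; rewrite cos_PI2, (phi_0_le k1 0), (phi_0_le k2 0) by lra; field; lra).
assert (Dc : forall w, continuous D w).
{ intros w; unfold D, Rdiv.
  apply (continuous_minus (fun w => psi k1 (cos w) * / phi k1 1)
           (fun w => psi k2 (cos w) * / phi k2 1));
  apply (continuous_mult (fun w => psi _ (cos w)) (fun _ => / phi _ 1));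
    try apply continuous_const; apply continuous_psi; assumption. }
assert (gc : forall w, continuous g w).
{ intros w; unfold g, Rdiv.
  apply (continuous_minus (fun w => phi k1 (cos w) * / phi k1 1)
           (fun w => phi k2 (cos w) * / phi k2 1));
  apply (continuous_mult (fun w => phi _ (cos w)) (fun _ => / phi _ 1));
    try apply continuous_const; apply continuous_phi; assumption. }
assert (g_der : forall w, 0 <= w < PI / 2 -> is_derive g w (tan w * D w)).
{ intros w Hw.
  assert (Hc : 0 < cos w) by (apply cos_gt_0; lra).
  assert (D1 := is_derive_phi_w k1 w H1 Hc).
  assert (D2 := is_derive_phi_w k2 w Hk2 Hc).
  apply is_derive_ext with
    (fun w => / phi k1 1 * phi k1 (cos w) - / phi k2 1 * phi k2 (cos w)).
  { intros t; unfold g, Rdiv; simpl; ring. }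
  replace (tan w * D w) with
    (/ phi k1 1 * (tan w * psi k1 (cos w)) - / phi k2 1 * (tan w * psi k2 (cos w)))
    by (unfold D, Rdiv; ring).
  apply (is_derive_minus (fun w => / phi k1 1 * phi k1 (cos w))
           (fun w => / phi k2 1 * phi k2 (cos w))); apply is_derive_scal; assumption. }
set (M := / phi k1 1 + / phi k2 1).
assert (i1 : 0 < / phi k1 1) by (apply Rinv_0_lt_compat, A3).
assert (i2 : 0 < / phi k2 1) by (apply Rinv_0_lt_compat, A4).
assert (HM : 0 < M) by (unfold M; lra).
assert (D_le : forall w, - M <= D w <= M).
{ intros w; unfold D, M, Rdiv.
  assert (B1 := psi_bounds k1 (cos w) H1); assert (B2 := psi_bounds k2 (cos w) Hk2).
  nra. }
assert (D_int : forall a b, ex_RInt D a b)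
  by (intros; apply (@ex_RInt_continuous R_CompleteNormedModule); intros; apply Dc).
set (J := fun w => RInt D 0 w - cos w / sin w * g w).
assert (J_der : forall w, 0 < w < PI / 2 -> is_derive J w (g w / sin w ^ 2)).
{ intros w Hw; unfold J.
  assert (Hs : 0 < sin w) by (apply sin_gt_0; lra).
  assert (Hc : 0 < cos w) by (apply cos_gt_0; lra).
  evar_last.
  - apply (is_derive_minus (RInt D 0) (fun w => cos w / sin w * g w)).
    + apply (is_derive_RInt D (RInt D 0) 0 w); [|apply Dc].
      apply filter_forall; intros; apply (@RInt_correct R_CompleteNormedModule), D_int.
    + apply (is_derive_mult (fun w => cos w / sin w) g).
      * auto_derive; [lra|reflexivity].
      * apply g_der; lra.
      * intros; apply Rmult_comm.
  - unfold minus, plus, opp, mult; simpl; unfold tan.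
    assert (T := sin2_cos2 w); unfold Rsqr in T.
    field_simplify_eq; [|lra].
    replace (cos w ^ 2) with (1 - sin w ^ 2) by nra.
    ring. }
assert (J_cont : forall w, 0 < w <= PI / 2 -> continuity_pt J w).
{ intros w Hw; unfold J; apply continuity_pt_filterlim.
  assert (Hs : 0 < sin w) by (apply sin_gt_0; lra).
  apply (continuous_minus (RInt D 0) (fun w => cos w / sin w * g w)).
  - apply (continuous_RInt_1 D 0 w (RInt D 0)).
    apply filter_forall; intros; apply (@RInt_correct R_CompleteNormedModule), D_int.
  - apply (continuous_mult (fun w => cos w / sin w) g); [|apply gc].
    apply (ex_derive_continuous (fun w => cos w / sin w)).
    auto_derive; lra. }
(* The inequality is not strict at the end point, where [g] vanishes. *)
assert (J_le : forall a b, 0 < a < b -> b <= PI / 2 -> J a <= J b).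
{ intros a b Hab Hb.
  destruct (MVT_gen J a b (fun w => g w / sin w ^ 2)) as [c [Hc E]].
  - rewrite Rmin_left, Rmax_right by lra; intros; apply J_der; lra.
  - rewrite Rmin_left, Rmax_right by lra; intros; apply J_cont; lra.
  - rewrite Rmin_left, Rmax_right in Hc by lra.
    assert (Hs : 0 < sin c) by (apply sin_gt_0; lra).
    assert (0 <= g c / sin c ^ 2).
    { apply Rmult_le_pos; [|left; apply Rinv_0_lt_compat; nra].
      destruct (Req_dec c (PI / 2)) as [->|]; [lra|left; apply g_pos; lra]. }
    nra. }
(* Strictness is gained between 1 and 5 / 4, both inside (0, PI / 2). *)
assert (J_lt : J 1 < J (5 / 4)).
{ destruct (MVT_gen J 1 (5 / 4) (fun w => g w / sin w ^ 2)) as [c [Hc E]].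
  - rewrite Rmin_left, Rmax_right by lra; intros; apply J_der; lra.
  - rewrite Rmin_left, Rmax_right by lra; intros; apply J_cont; lra.
  - rewrite Rmin_left, Rmax_right in Hc by lra.
    assert (Hs : 0 < sin c) by (apply sin_gt_0; lra).
    assert (0 < g c / sin c ^ 2).
    { apply Rdiv_lt_0_compat; [apply g_pos; lra|nra]. }
    nra. }
(* Near 0 the mean value theorem gives [g e <= e * tan e * M], so the boundary
   term is at most [M * e], and so is the integral. *)
assert (J_small : forall e, 0 < e < 1 -> - (2 * M) * e <= J e).
{ intros e He; unfold J.
  assert (Hs : 0 < sin e) by (apply sin_gt_0; lra).
  assert (Hc : 0 < cos e) by (apply cos_gt_0; lra).
  assert (R1 : - M * e <= RInt D 0 e).
  { rewrite <- (Rminus_0_r e) at 1.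
    apply RInt_ge_const; [lra|apply D_int|intros; apply D_le]. }
  destruct (MVT_gen g 0 e (fun w => tan w * D w)) as [c [Hce E]].
  - rewrite Rmin_left, Rmax_right by lra; intros; apply g_der; lra.
  - intros; apply continuity_pt_filterlim, gc.
  - rewrite Rmin_left, Rmax_right in Hce by lra.
    rewrite g_0, !Rminus_0_r in E; rewrite E.
    assert (T : 0 <= tan c <= tan e).
    { split.
      - destruct (Req_dec c 0) as [->|]; [rewrite tan_0; lra|].
        left; apply tan_gt_0; lra.
      - destruct (Req_dec c e) as [->|]; [lra|].
        left; apply tan_increasing; lra. }
    assert (TD : tan c * D c <= tan e * M).
    { assert (B := D_le c); nra. }
    assert (cos e / sin e * (tan c * D c * e) <= M * e); [|nra].
    replace (M * e) with (cos e / sin e * (tan e * M * e))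
      by (unfold tan; field; lra).
    apply Rmult_le_compat_l; [left; apply Rdiv_lt_0_compat; assumption|].
    apply Rmult_le_compat_r; lra. }
assert (J1 : 0 <= J 1).
{ apply Rnot_lt_le; intros Hn.
  set (e := Rmin (1 / 2) (- J 1 / (4 * M))).
  assert (He : 0 < e) by (apply Rmin_pos; [lra|apply Rdiv_lt_0_compat; lra]).
  assert (He1 : e <= 1 / 2) by apply Rmin_l.
  assert (He2 : e <= - J 1 / (4 * M)) by apply Rmin_r.
  assert (Q1 := J_small e ltac:(lra)).
  assert (Q2 := J_le e 1 ltac:(lra) ltac:(lra)).
  assert (Q3 : (2 * M) * e <= - J 1 / 2).
  { replace (- J 1 / 2) with ((2 * M) * (- J 1 / (4 * M))) by (field; lra).
    apply Rmult_le_compat_l; lra. }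
  lra. }
assert (J2 := J_le (5 / 4) (PI / 2) ltac:(lra) ltac:(lra)).
assert (J3 : 0 < J (PI / 2)) by lra.
unfold J in J3; rewrite g_end, Rmult_0_r, Rminus_0_r in J3.
assert (E : RInt D 0 (PI / 2) = slope k1 / phi k1 1 - slope k2 / phi k2 1).
{ unfold D, slope.
  transitivity (RInt (fun w => / phi k1 1 * psi k1 (cos w)
                        - / phi k2 1 * psi k2 (cos w)) 0 (PI / 2)).
  - apply RInt_ext; intros w _; simpl; field; lra.
  - etransitivity.
    + apply (RInt_minus (fun w => / phi k1 1 * psi k1 (cos w))
                        (fun w => / phi k2 1 * psi k2 (cos w)));
        [apply (ex_RInt_scal (fun w => psi k1 (cos w)))
        |apply (ex_RInt_scal (fun w => psi k2 (cos w)))];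
        apply ex_RInt_psi; assumption.
    + rewrite !RInt_scal_R by (apply ex_RInt_psi; assumption).
      unfold minus, plus, opp; simpl; field; lra. }
lra.
Qed.

Lemma psi_eq (k q : R) : psi k q = phi k q * ((2 * beta k q - 1) * (beta k q + 1) / 2).
Proof. reflexivity. Qed.

(** Here [beta 2 q < 1 / 2] for all [q] in [(0, 1)], so [psi] is
    negative throughout. *)
Lemma slope_neg_at_2 : slope 2 < 0.
Proof.
assert (HPI := PI2_3_2).
apply Ropp_lt_cancel; rewrite Ropp_0.
unfold slope.
replace (- RInt (fun w => psi 2 (cos w)) 0 (PI / 2))
  with (RInt (fun w => - psi 2 (cos w)) 0 (PI / 2))
  by (apply (RInt_opp (fun w => psi 2 (cos w))), ex_RInt_psi; lra).
apply RInt_gt_0; [lra| |].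
- intros w Hw; apply cos_bounds in Hw.
  assert (P := phi_gt_0 2 (cos w) ltac:(lra) ltac:(lra)).
  assert (B := beta_gt_0 2 (cos w) ltac:(lra) ltac:(lra)).
  assert (beta 2 (cos w) < 1 / 2).
  { apply Rsqr_incrst_0; [|lra|lra].
    replace (Rsqr (beta 2 (cos w))) with (beta 2 (cos w) ^ 2)
      by (unfold Rsqr; ring).
    rewrite beta_sqr by lra; unfold Rsqr.
    apply Rmult_lt_reg_r with (cos w ^ 2 + 2 ^ 2); [nra|].
    unfold Rdiv at 1; rewrite Rmult_assoc, Rinv_l by nra. nra. }
  rewrite psi_eq.
  assert (0 < phi 2 (cos w) * ((1 - 2 * beta 2 (cos w)) * (beta 2 (cos w) + 1) / 2))
    by (apply Rmult_lt_0_compat; [exact P|nra]).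
  lra.
- intros w _; apply (continuous_opp (fun w => psi 2 (cos w))), continuous_psi; lra.
Qed.

(** Cut the interval at 1 and at [PI / 2 - 1 / 8].  On the first piece
    [psi >= 65 / 1000], on the second [psi >= 0] because [beta >= 1 / 2], and
    on the last, of length [1 / 8], [psi >= - 1 / 4]. *)
Lemma slope_pos_at_tenth : 0 < slope (1 / 10).
Proof.
assert (HPI := PI2_3_2).
assert (Hk : 0 < 1 / 10) by lra.
set (b := PI / 2 - 1 / 8).
assert (X : forall a c, ex_RInt (fun w => psi (1 / 10) (cos w)) a c)
  by (intros; apply ex_RInt_psi; lra).
unfold slope.
rewrite <- (RInt_Chasles _ 0 b (PI / 2)), <- (RInt_Chasles _ 0 1 b) by apply X.
unfold plus; simpl.
assert (Hb : 1 / 16 <= cos b).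
(* [sin (1 / 8) >= 1 / 16], by the mean value theorem and [cos >= 1 / 2] on
   [[0, 1]]. *)
{ unfold b; rewrite cos_shift.
  destruct (MVT_gen sin 0 (1 / 8) cos) as [c [Hc E]].
  - intros; auto_derive; [exact I|ring].
  - intros; apply continuity_sin.
  - rewrite Rmin_left, Rmax_right in Hc by lra.
    rewrite sin_0, !Rminus_0_r in E; rewrite E.
    assert (1 / 2 <= cos c).
    { rewrite <- cos_PI3; apply cos_decr_1; lra. }
    lra. }
assert (I1 : 65 / 1000 * (1 - 0) <= RInt (fun w => psi (1 / 10) (cos w)) 0 1).
{ apply RInt_ge_const; [lra|apply X|].
  intros w Hw.
  assert (Hq : 1 / 2 <= cos w) by (rewrite <- cos_PI3; apply cos_decr_1; lra).
  assert (Hq1 := COS_bound w).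
  set (q := cos w) in *.
  assert (B2 := beta_sqr (1 / 10) q Hk).
  assert (B1 := beta_lt_1 (1 / 10) q Hk).
  assert (B0 := beta_gt_0 (1 / 10) q Hk ltac:(lra)).
  assert (Hm : 0 < q ^ 2 + (1 / 10) ^ 2) by nra.
  assert (E : beta (1 / 10) q ^ 2 * (q ^ 2 + (1 / 10) ^ 2) = q ^ 2)
    by (rewrite B2; field; nra).
  assert (C1 : 98 / 100 <= beta (1 / 10) q).
  { apply Rnot_lt_le; intros Hn.
    assert (beta (1 / 10) q ^ 2 <= (98 / 100) ^ 2) by nra. nra. }
  assert (C2 : 99 / 10000 <= 1 - beta (1 / 10) q ^ 2) by nra.
  assert (C3 : 495 / 100000 <= 1 - beta (1 / 10) q) by nra.
  assert (C4 : 69 / 1000 <= phi (1 / 10) q).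
  { unfold phi; rewrite <- (sqrt_pow2 (69 / 1000)) by lra.
    apply sqrt_le_1_alt; nra. }
  rewrite psi_eq.
  assert (95 / 100 <= (2 * beta (1 / 10) q - 1) * (beta (1 / 10) q + 1) / 2) by nra.
  nra. }
assert (I2 : 0 * (b - 1) <= RInt (fun w => psi (1 / 10) (cos w)) 1 b).
{ rewrite Rmult_0_l; apply RInt_ge_0; [unfold b; lra|apply X|].
  intros w Hw.
  assert (Hq : 1 / 16 <= cos w).
  { apply Rle_trans with (1 := Hb); apply cos_decr_1; unfold b in *; lra. }
  set (q := cos w) in *.
  assert (B2 := beta_sqr (1 / 10) q Hk).
  assert (B0 := beta_gt_0 (1 / 10) q Hk ltac:(lra)).
  assert (P := phi_gt_0 (1 / 10) q Hk ltac:(lra)).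
  assert (E : beta (1 / 10) q ^ 2 * (q ^ 2 + (1 / 10) ^ 2) = q ^ 2)
    by (rewrite B2; field; nra).
  assert (C1 : 1 / 2 <= beta (1 / 10) q).
  { apply Rnot_lt_le; intros Hn.
    assert (beta (1 / 10) q ^ 2 <= (1 / 2) ^ 2) by nra. nra. }
  rewrite psi_eq; apply Rmult_le_pos; [lra|nra]. }
assert (I3 : -1 / 4 * (PI / 2 - b) <= RInt (fun w => psi (1 / 10) (cos w)) b (PI / 2)).
{ apply RInt_ge_const; [unfold b; lra|apply X|].
  intros; apply psi_bounds, Hk. }
unfold b in I3 at 1; lra.
Qed.

(** The supremum of the set where [slope] is positive works, because the
    monotone ratio forces positivity to the left of any nonnegative value. *)
Lemma slope_sign_change :
  exists k0, 0 < k0 /\ (forall k, 0 < k < k0 -> 0 < slope k)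
    /\ (forall k, k0 < k -> slope k < 0).
Proof.
assert (mono : forall a b, 0 < a < b -> 0 <= slope b -> 0 < slope a).
{ intros a b Hab Hb.
  assert (H := slope_ratio_decr a b Hab).
  assert (Pa := phi_gt_0 a 1 ltac:(lra) Rlt_0_1).
  assert (Pb := phi_gt_0 b 1 ltac:(lra) Rlt_0_1).
  assert (0 <= slope b / phi b 1)
    by (apply Rmult_le_pos; [exact Hb|left; apply Rinv_0_lt_compat, Pb]).
  replace (slope a) with (slope a / phi a 1 * phi a 1) by (field; lra).
  apply Rmult_lt_0_compat; lra. }
destruct (completeness (fun k => 0 < k /\ 0 < slope k)) as [k0 [U L]].
- exists 2; intros k [Hk Hs]; apply Rnot_lt_le; intros Hn.
  assert (H := mono 2 k ltac:(lra) ltac:(lra)).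
  assert (H' := slope_neg_at_2); lra.
- exists (1 / 10); split; [lra|apply slope_pos_at_tenth].
- assert (Hk0 : 1 / 10 <= k0) by (apply U; split; [lra|apply slope_pos_at_tenth]).
  exists k0; split; [lra|split].
  + intros k Hk.
    apply Rnot_le_lt; intros Hn.
    assert (k0 <= k); [|lra].
    apply L; intros k' [Hk' Hs]; apply Rnot_lt_le; intros Hlt.
    assert (H := mono k k' ltac:(lra) ltac:(lra)); lra.
  + intros k Hk.
    apply Rnot_le_lt; intros Hn.
    assert (H := mono ((k0 + k) / 2) k ltac:(lra) Hn).
    assert ((k0 + k) / 2 <= k0) by (apply U; split; [lra|exact H]).
    lra.
Qed.

Lemma halfsep_max (k0 : R) :
  0 < k0 -> (forall k, 0 < k < k0 -> 0 < slope k) ->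
  (forall k, k0 < k -> slope k < 0) ->
  forall k, 0 < k -> k <> k0 -> halfsep k < halfsep k0.
Proof.
intros H0 Hl Hr k Hk Hne.
assert (H2 : 0 < / sqrt 2) by (apply Rinv_0_lt_compat, sqrt_lt_R0; lra).
assert (Dc : forall x, 0 < x -> derivable_pt_lim halfsep x (/ sqrt 2 * (slope x / x)))
  by (intros; apply is_derive_Reals, is_derive_halfsep; assumption).
assert (P : forall x, 0 < x -> 0 < / x) by (intros; apply Rinv_0_lt_compat; assumption).
destruct (Rtotal_order k k0) as [Hlt|[Heq|Hgt]]; [|contradiction|].
- destruct (MVT_cor2 halfsep (fun x => / sqrt 2 * (slope x / x)) k k0 Hlt)
    as [x [E Hx]]; [intros; apply Dc; lra|].
  assert (S := Hl x ltac:(lra)); assert (Q := P x ltac:(lra)).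
  assert (0 < / sqrt 2 * (slope x / x))
    by (apply Rmult_lt_0_compat; [exact H2|apply Rmult_lt_0_compat; assumption]).
  nra.
- destruct (MVT_cor2 halfsep (fun x => / sqrt 2 * (slope x / x)) k0 k Hgt)
    as [x [E Hx]]; [intros; apply Dc; lra|].
  assert (S := Hr x ltac:(lra)); assert (Q := P x ltac:(lra)).
  assert (0 < / sqrt 2 * (- slope x / x))
    by (apply Rmult_lt_0_compat; [exact H2|apply Rmult_lt_0_compat; lra]).
  unfold Rdiv in *; nra.
Qed.

(** * The generating curve in arc length and in the angle *)

(** [cosh (2 r)], where [r] is the distance to the axis; the factor
    [sqrt (1 + k ^ 2)] is its value at the neck. *)
Definition cosh2r (k s : R) : R := sqrt (1 + k ^ 2) * cosh (2 * s).

(** [sinh r], the radius of the circle of rotation. *)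
Definition rad (k s : R) : R := sqrt ((cosh2r k s - 1) / 2).

(** [cosh r]. *)
Definition rho (k s : R) : R := sqrt ((cosh2r k s + 1) / 2).

(** Chosen so that [cos (angle k s) = k / sinh (2 r)], which makes the
    integrand of the translation a function of [k / cos w] on a bounded
    interval. *)
Definition angle (k s : R) : R := atan (sqrt (1 + k ^ 2) * sinh (2 * s) / k).

(** Derivative of the translation along the axis: constancy of the flux means
    [speed * rad * rho ^ 2 = k / 2]. *)
Definition speed (k s : R) : R := k / (2 * rho k s ^ 2 * rad k s).

(** [rad] as a function of the cosine of the angle. *)
Definition radq (k q : R) : R := sqrt ((sqrt (q ^ 2 + k ^ 2) / q - 1) / 2).

Lemma cosh_neck_gt_1 (k : R) : 0 < k -> 1 < sqrt (1 + k ^ 2).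
Proof. intros Hk; rewrite <- sqrt_1 at 1; apply sqrt_lt_1_alt; nra. Qed.

Lemma cosh_neck_sqr (k : R) : sqrt (1 + k ^ 2) ^ 2 = 1 + k ^ 2.
Proof. apply pow2_sqrt; nra. Qed.

Lemma cosh2r_gt_1 (k s : R) : 0 < k -> 1 < cosh2r k s.
Proof.
intros Hk; unfold cosh2r.
assert (H1 := cosh_neck_gt_1 k Hk); assert (H2 := cosh_ge_1 (2 * s)); nra.
Qed.

Lemma cosh2r_sqr (k s : R) :
  cosh2r k s ^ 2 - 1 = k ^ 2 + (sqrt (1 + k ^ 2) * sinh (2 * s)) ^ 2.
Proof.
unfold cosh2r; rewrite !Rpow_mult_distr, cosh_sqr, cosh_neck_sqr; ring.
Qed.

Lemma rad_gt_0 (k s : R) : 0 < k -> 0 < rad k s.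
Proof. intros Hk; apply sqrt_lt_R0; assert (H := cosh2r_gt_1 k s Hk); lra. Qed.

Lemma rad_sqr (k s : R) : 0 < k -> rad k s ^ 2 = (cosh2r k s - 1) / 2.
Proof. intros Hk; apply pow2_sqrt; assert (H := cosh2r_gt_1 k s Hk); lra. Qed.

Lemma rho_gt_0 (k s : R) : 0 < k -> 0 < rho k s.
Proof. intros Hk; apply sqrt_lt_R0; assert (H := cosh2r_gt_1 k s Hk); lra. Qed.

Lemma rho_sqr (k s : R) : 0 < k -> rho k s ^ 2 = (cosh2r k s + 1) / 2.
Proof. intros Hk; apply pow2_sqrt; assert (H := cosh2r_gt_1 k s Hk); lra. Qed.

Lemma is_derive_cosh2r (k s : R) :
  is_derive (cosh2r k) s (2 * (sqrt (1 + k ^ 2) * sinh (2 * s))).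
Proof.
unfold cosh2r.
replace (2 * (sqrt (1 + k ^ 2) * sinh (2 * s)))
  with (sqrt (1 + k ^ 2) * (2 * sinh (2 * s))) by ring.
apply is_derive_scal.
apply (is_derive_comp cosh (fun r => 2 * r)); [apply is_derive_cosh|].
auto_derive; [exact I|ring].
Qed.

Lemma is_derive_rad (k s : R) : 0 < k ->
  is_derive (rad k) s (sqrt (1 + k ^ 2) * sinh (2 * s) / (2 * rad k s)).
Proof.
intros Hk; assert (H := rad_gt_0 k s Hk); assert (Hx := cosh2r_gt_1 k s Hk).
evar_last.
- apply (is_derive_comp (fun y => sqrt ((y - 1) / 2)) (cosh2r k));
    [auto_derive; [lra|reflexivity]|apply is_derive_cosh2r].
- unfold scal; simpl; unfold mult; simpl.
  change (sqrt ((cosh2r k s + - (1)) * / 2)) with (rad k s).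
  field; lra.
Qed.

Lemma is_derive_rho (k s : R) : 0 < k ->
  is_derive (rho k) s (sqrt (1 + k ^ 2) * sinh (2 * s) / (2 * rho k s)).
Proof.
intros Hk; assert (H := rho_gt_0 k s Hk); assert (Hx := cosh2r_gt_1 k s Hk).
evar_last.
- apply (is_derive_comp (fun y => sqrt ((y + 1) / 2)) (cosh2r k));
    [auto_derive; [lra|reflexivity]|apply is_derive_cosh2r].
- unfold scal; simpl; unfold mult; simpl.
  change (sqrt ((cosh2r k s + 1) * / 2)) with (rho k s).
  field; lra.
Qed.

Lemma continuous_rad (k s : R) : 0 < k -> continuous (rad k) s.
Proof.
intros Hk; apply (ex_derive_continuous (rad k)).
eexists; apply is_derive_rad, Hk.
Qed.

Lemma ex_RInt_rad (k a b : R) : 0 < k -> ex_RInt (rad k) a b.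
Proof.
intros Hk; apply (@ex_RInt_continuous R_CompleteNormedModule); intros.
apply continuous_rad, Hk.
Qed.

Lemma continuous_speed (k s : R) : 0 < k -> continuous (speed k) s.
Proof.
intros Hk; apply (ex_derive_continuous (speed k)).
assert (H := rad_gt_0 k s Hk); assert (H' := rho_gt_0 k s Hk).
unfold speed; auto_derive.
split; [eexists; apply is_derive_rho, Hk|split; [eexists; apply is_derive_rad, Hk|]].
split; [|exact I].
apply Rgt_not_eq, Rmult_lt_0_compat; [|exact H].
change (rho k s * (rho k s * 1)) with (rho k s ^ 2).
assert (0 < rho k s ^ 2) by (apply pow_lt, H'); lra.
Qed.

Lemma ex_RInt_speed (k a b : R) : 0 < k -> ex_RInt (speed k) a b.
Proof.
intros Hk; apply (@ex_RInt_continuous R_CompleteNormedModule); intros.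
apply continuous_speed, Hk.
Qed.

Lemma angle_0 (k : R) : angle k 0 = 0.
Proof.
unfold angle; rewrite Rmult_0_r, sinh_0; unfold Rdiv.
rewrite Rmult_0_r, Rmult_0_l; apply atan_0.
Qed.

Lemma is_derive_angle (k s : R) : 0 < k ->
  is_derive (angle k) s (2 * cosh2r k s * k / (cosh2r k s ^ 2 - 1)).
Proof.
intros Hk.
assert (Hx := cosh2r_gt_1 k s Hk).
evar_last.
- apply (is_derive_comp atan (fun r => sqrt (1 + k ^ 2) * sinh (2 * r) / k)).
  + apply is_derive_atan.
  + apply (is_derive_ext (fun r => sqrt (1 + k ^ 2) / k * sinh (2 * r)));
      [intros; simpl; field; lra|].
    apply is_derive_scal.
    apply (is_derive_comp sinh (fun r => 2 * r)); [apply is_derive_sinh|].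
    auto_derive; [exact I|reflexivity].
- assert (E := cosh2r_sqr k s); rewrite E.
  unfold cosh2r, scal; simpl; unfold mult; simpl; unfold Rsqr.
  field; split; [|lra].
  apply Rgt_not_eq; nra.
Qed.

Lemma cos_angle (k s : R) : 0 < k -> cos (angle k s) = k / sqrt (cosh2r k s ^ 2 - 1).
Proof.
intros Hk; assert (Hx := cosh2r_gt_1 k s Hk).
unfold angle; rewrite cos_atan.
set (y := sqrt (1 + k ^ 2) * sinh (2 * s)).
replace (1 + Rsqr (y / k)) with ((cosh2r k s ^ 2 - 1) / k ^ 2).
- rewrite sqrt_div_alt by nra; rewrite sqrt_pow2 by lra.
  assert (0 < sqrt (cosh2r k s ^ 2 - 1)) by (apply sqrt_lt_R0; nra).
  field; lra.
- rewrite cosh2r_sqr; fold y; unfold Rsqr; field; lra.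
Qed.

Lemma cos_angle_gt_0 (k s : R) : 0 < k -> 0 < cos (angle k s).
Proof.
intros Hk; assert (Hx := cosh2r_gt_1 k s Hk).
rewrite cos_angle by exact Hk.
apply Rdiv_lt_0_compat; [exact Hk|apply sqrt_lt_R0; nra].
Qed.

Lemma cos_angle_hyp (k s : R) : 0 < k ->
  sqrt (cos (angle k s) ^ 2 + k ^ 2) = cosh2r k s * cos (angle k s).
Proof.
intros Hk; assert (Hx := cosh2r_gt_1 k s Hk).
assert (Hc := cos_angle_gt_0 k s Hk).
rewrite <- (sqrt_pow2 (cosh2r k s * cos (angle k s))) by nra.
f_equal.
rewrite cos_angle by exact Hk.
unfold Rdiv; rewrite !Rpow_mult_distr, pow_inv, pow2_sqrt by nra.
field; nra.
Qed.

Lemma phi_angle (k s : R) : 0 < k ->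
  phi k (cos (angle k s)) = sqrt 2 * rad k s / cosh2r k s.
Proof.
intros Hk; assert (Hx := cosh2r_gt_1 k s Hk).
assert (Hc := cos_angle_gt_0 k s Hk).
assert (Hr := rad_gt_0 k s Hk).
assert (H2 : 0 < sqrt 2) by (apply sqrt_lt_R0; lra).
unfold phi, beta; rewrite cos_angle_hyp by exact Hk.
rewrite <- (sqrt_pow2 (sqrt 2 * rad k s / cosh2r k s)).
2:{ apply Rmult_le_pos; [nra|left; apply Rinv_0_lt_compat; lra]. }
f_equal.
unfold Rdiv; rewrite !Rpow_mult_distr, (pow2_sqrt 2), rad_sqr, pow_inv by lra.
field; lra.
Qed.

Lemma RInt_speed_angle (k s : R) : 0 < k ->
  RInt (speed k) 0 s = / sqrt 2 * RInt (fun w => phi k (cos w)) 0 (angle k s).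
Proof.
intros Hk.
assert (H2 : 0 < sqrt 2) by (apply sqrt_lt_R0; lra).
rewrite <- RInt_scal_R by (apply ex_RInt_phi, Hk).
apply is_RInt_unique.
replace (RInt (fun w => / sqrt 2 * phi k (cos w)) 0 (angle k s))
  with (RInt (fun w => / sqrt 2 * phi k (cos w)) (angle k 0) (angle k s))
  by (rewrite angle_0; reflexivity).
apply is_RInt_ext with
  (fun r => scal (2 * cosh2r k r * k / (cosh2r k r ^ 2 - 1)) (/ sqrt 2 * phi k (cos (angle k r)))).
- intros r _; assert (Hx := cosh2r_gt_1 k r Hk); assert (Hr := rad_gt_0 k r Hk).
  unfold scal; simpl; unfold mult; simpl.
  rewrite phi_angle by exact Hk.
  unfold speed; rewrite rho_sqr by exact Hk.
  assert (E := rad_sqr k r Hk).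
  replace (cosh2r k r * (cosh2r k r * 1) - 1) with ((cosh2r k r + 1) * (2 * rad k r ^ 2))
    by (rewrite E; field).
  field; repeat split; lra.
- apply (is_RInt_comp (fun w => / sqrt 2 * phi k (cos w)) (angle k)).
  + intros r _; apply (continuous_mult (fun _ => / sqrt 2) (fun w => phi k (cos w)));
      [apply continuous_const|apply continuous_phi, Hk].
  + intros r _; split; [apply is_derive_angle, Hk|].
    assert (Hx := cosh2r_gt_1 k r Hk).
    apply (ex_derive_continuous (fun r => 2 * cosh2r k r * k / (cosh2r k r ^ 2 - 1))).
    auto_derive.
    split; [eexists; apply is_derive_cosh2r|split; [eexists; apply is_derive_cosh2r|]].
    split; [apply Rgt_not_eq; nra|exact I].
Qed.

(** Substitution of the angle in the area: the integrand is that of the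
    translation times the flux [k / 2] and [/ cos w ^ 2]. *)
Lemma RInt_rad_angle (k s : R) : 0 < k ->
  RInt (rad k) 0 s
  = k / (2 * sqrt 2) * RInt (fun w => phi k (cos w) * / cos w ^ 2) 0 (angle k s).
Proof.
intros Hk.
assert (H2 : 0 < sqrt 2) by (apply sqrt_lt_R0; lra).
assert (C : forall w, 0 < cos w -> continuous (fun w => phi k (cos w) * / cos w ^ 2) w).
{ intros w Hw; apply (continuous_mult (fun w => phi k (cos w)) (fun w => / cos w ^ 2)).
  - apply continuous_phi, Hk.
  - apply (ex_derive_continuous (fun w => / cos w ^ 2)).
    auto_derive; apply Rgt_not_eq; nra. }
assert (S : forall w, Rmin 0 (angle k s) <= w <= Rmax 0 (angle k s) -> 0 < cos w).
{ intros w Hw; assert (B := atan_bound (sqrt (1 + k ^ 2) * sinh (2 * s) / k)).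
  fold (angle k s) in B; assert (HPI := PI_RGT_0).
  unfold Rmin, Rmax in Hw; destruct (Rle_dec 0 (angle k s));
  apply cos_gt_0; lra. }
rewrite <- RInt_scal_R.
2:{ apply (@ex_RInt_continuous R_CompleteNormedModule); intros; apply C, S; assumption. }
apply is_RInt_unique.
set (f := fun w => k / (2 * sqrt 2) * (phi k (cos w) * / cos w ^ 2)).
replace (RInt f 0 (angle k s)) with (RInt f (angle k 0) (angle k s))
  by (rewrite angle_0; reflexivity).
apply is_RInt_ext with
  (fun r => scal (2 * cosh2r k r * k / (cosh2r k r ^ 2 - 1)) (f (angle k r))).
- intros r _; assert (Hx := cosh2r_gt_1 k r Hk); assert (Hr := rad_gt_0 k r Hk).
  unfold f, scal; simpl; unfold mult; simpl.
  replace (cos (angle k r) * (cos (angle k r) * 1)) with (cos (angle k r) ^ 2) by ring.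
  replace (cos (angle k r) ^ 2) with (k ^ 2 / (cosh2r k r ^ 2 - 1))
    by (rewrite cos_angle by exact Hk; unfold Rdiv;
        rewrite Rpow_mult_distr, pow_inv, pow2_sqrt by nra; reflexivity).
  rewrite phi_angle by exact Hk.
  field; repeat split; try lra; apply Rgt_not_eq; nra.
- apply (is_RInt_comp f (angle k)).
  + intros r _.
    apply (continuous_mult (fun _ => k / (2 * sqrt 2)) (fun w => phi k (cos w) * / cos w ^ 2));
      [apply continuous_const|apply C, cos_angle_gt_0, Hk].
  + intros r _; split; [apply is_derive_angle, Hk|].
    assert (Hx := cosh2r_gt_1 k r Hk).
    apply (ex_derive_continuous (fun r => 2 * cosh2r k r * k / (cosh2r k r ^ 2 - 1))).
    auto_derive.
    split; [eexists; apply is_derive_cosh2r|split; [eexists; apply is_derive_cosh2r|]].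
    split; [apply Rgt_not_eq; nra|exact I].
Qed.

Lemma radq_angle (k s : R) : 0 < k -> radq k (cos (angle k s)) = rad k s.
Proof.
intros Hk; assert (Hc := cos_angle_gt_0 k s Hk).
unfold radq, rad; rewrite cos_angle_hyp by exact Hk.
do 3 f_equal; field; lra.
Qed.

Lemma rad_lower (k s : R) : 0 < k ->
  sqrt (sqrt (1 + k ^ 2) - 1) / 2 * exp s <= rad k s.
Proof.
intros Hk; assert (H1 := cosh_neck_gt_1 k Hk).
assert (He := exp_pos s); assert (Hs := sqrt_pos (sqrt (1 + k ^ 2) - 1)).
unfold rad; rewrite <- (sqrt_pow2 (sqrt (sqrt (1 + k ^ 2) - 1) / 2 * exp s)) by nra.
apply sqrt_le_1_alt.
unfold Rdiv at 1; rewrite !Rpow_mult_distr, pow2_sqrt by lra.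
rewrite <- exp_double; unfold cosh2r.
assert (Hc := cosh_ge_1 (2 * s)).
assert (exp (2 * s) <= 2 * cosh (2 * s)).
{ unfold cosh; assert (X := exp_pos (- (2 * s))); lra. }
nra.
Qed.

Lemma rad_upper (k s : R) : 0 < k -> 0 <= s ->
  rad k s <= sqrt (sqrt (1 + k ^ 2)) * exp s.
Proof.
intros Hk Hs; assert (H1 := cosh_neck_gt_1 k Hk).
assert (He := exp_pos s).
unfold rad; rewrite <- (sqrt_pow2 (exp s)) by lra.
rewrite <- sqrt_mult_alt by lra.
apply sqrt_le_1_alt; rewrite <- exp_double; unfold cosh2r.
assert (cosh (2 * s) <= exp (2 * s)).
{ unfold cosh; assert (exp (- (2 * s)) <= exp (2 * s)); [|lra].
  destruct (Req_dec s 0) as [->|]; [right; f_equal; ring|left; apply exp_increasing; lra]. }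
assert (X := exp_pos (2 * s)); nra.
Qed.

(** * The regularized area *)

(** By the area growth [int_0^S rad ~ rad S] this difference stays
    bounded. *)
Definition excess (k S : R) : R := RInt (rad k) 0 S - rad k S.

Definition limit_excess (k : R) : R := real (Lim (excess k) p_infty).

(** The derivative in [S] is
    [(sqrt (1 + k ^ 2) * exp (- 2 S) - 1) / (2 rad)], and [rad] grows like
    [exp S]. *)
Lemma is_lim_excess (k : R) : 0 < k -> is_lim (excess k) p_infty (limit_excess k).
Proof.
intros Hk.
assert (H1 := cosh_neck_gt_1 k Hk).
set (m := sqrt (sqrt (1 + k ^ 2) - 1) / 2).
assert (Hm : 0 < m) by (unfold m; apply Rdiv_lt_0_compat; [apply sqrt_lt_R0|]; lra).
destruct (ex_lim_exp_decay (excess k)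
   (fun s => rad k s - sqrt (1 + k ^ 2) * sinh (2 * s) / (2 * rad k s))
   ((sqrt (1 + k ^ 2) + 1) / (2 * m))) as [l Hl].
- intros s _; unfold excess.
  apply (is_derive_minus (RInt (rad k) 0) (rad k)); [|apply is_derive_rad, Hk].
  apply (is_derive_RInt (rad k) (RInt (rad k) 0) 0); [|apply continuous_rad, Hk].
  apply filter_forall; intros; apply (@RInt_correct R_CompleteNormedModule), ex_RInt_rad, Hk.
- intros s Hs.
  assert (Hr := rad_gt_0 k s Hk).
  assert (Hl := rad_lower k s Hk); fold m in Hl.
  assert (E := rad_sqr k s Hk).
  assert (He := exp_pos s).
  replace (rad k s - sqrt (1 + k ^ 2) * sinh (2 * s) / (2 * rad k s))
    with ((sqrt (1 + k ^ 2) * exp (- (2 * s)) - 1) * / (2 * rad k s)).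
  2:{ replace (sqrt (1 + k ^ 2) * exp (- (2 * s)) - 1)
       with (2 * rad k s ^ 2 - sqrt (1 + k ^ 2) * sinh (2 * s))
       by (rewrite E; unfold cosh2r, cosh, sinh; field).
      field; lra. }
  rewrite Rabs_mult, (Rabs_pos_eq (/ (2 * rad k s)))
    by (left; apply Rinv_0_lt_compat; lra).
  rewrite (exp_Ropp s).
  apply Rle_trans with ((sqrt (1 + k ^ 2) + 1) * / (2 * (m * exp s))).
  + apply Rmult_le_compat; [apply Rabs_pos|left; apply Rinv_0_lt_compat; lra| |].
    * assert (exp (- (2 * s)) <= 1) by (rewrite <- exp_0; left; apply exp_increasing; lra).
      assert (X := exp_pos (- (2 * s))).
      assert (0 <= sqrt (1 + k ^ 2) * exp (- (2 * s)) <= sqrt (1 + k ^ 2))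
        by (split; nra).
      apply Rabs_le; lra.
    * apply Rinv_le_contravar; [|lra]. nra.
  + right; field; lra.
- unfold limit_excess; rewrite (is_lim_unique _ _ _ Hl); exact Hl.
Qed.

(** * First variation of the regularized area *)

(** [excess] as a function of the angle [W] of the end point.  At fixed [W]
    the range of integration is the same for all [k], so that catenoids with
    different [k] can be compared. *)
Definition excess_angle (k W : R) : R :=
  k / (2 * sqrt 2) * RInt (fun w => phi k (cos w) * / cos w ^ 2) 0 W
  - radq k (cos W).

Lemma excess_angle_eq (k Y : R) : 0 < k ->
  excess k (arcsinh (k * Y / sqrt (1 + k ^ 2)) / 2) = excess_angle k (atan Y).
Proof.
intros Hk; assert (H1 := cosh_neck_gt_1 k Hk).
set (s := arcsinh (k * Y / sqrt (1 + k ^ 2)) / 2).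
assert (E : angle k s = atan Y).
{ unfold angle; f_equal; unfold s.
  replace (2 * (arcsinh (k * Y / sqrt (1 + k ^ 2)) / 2))
    with (arcsinh (k * Y / sqrt (1 + k ^ 2))) by field.
  rewrite sinh_arcsinh; field; lra. }
unfold excess, excess_angle.
rewrite RInt_rad_angle, <- (radq_angle k s), E by exact Hk; reflexivity.
Qed.

Lemma is_lim_excess_angle (k : R) : 0 < k ->
  is_lim (fun Y => excess_angle k (atan Y)) p_infty (limit_excess k).
Proof.
intros Hk; assert (H1 := cosh_neck_gt_1 k Hk).
apply is_lim_ext with
  (fun Y => excess k (arcsinh (k * Y / sqrt (1 + k ^ 2)) / 2)).
{ intros Y; apply excess_angle_eq, Hk. }
apply (is_lim_comp (excess k) (fun Y => arcsinh (k * Y / sqrt (1 + k ^ 2)) / 2)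
         p_infty (limit_excess k) p_infty).
- apply is_lim_excess, Hk.
- apply is_lim_spec; intros M.
  destruct (proj2 (is_lim_spec _ _ _) is_lim_arcsinh_p (2 * M)) as [N HN].
  exists (N * sqrt (1 + k ^ 2) / k); intros Y HY.
  assert (N < k * Y / sqrt (1 + k ^ 2)).
  { apply Rmult_lt_reg_r with (sqrt (1 + k ^ 2) / k);
      [apply Rdiv_lt_0_compat; lra|].
    replace (k * Y / sqrt (1 + k ^ 2) * (sqrt (1 + k ^ 2) / k)) with Y
      by (field; lra).
    unfold Rdiv in *; lra. }
  assert (A := HN _ H); lra.
- exists 0; discriminate.
Qed.

Lemma is_derive_radq (k q : R) : 0 < k -> 0 < q ->
  is_derive (fun z => radq z q) k
    (k / (4 * q * sqrt (q ^ 2 + k ^ 2) * radq k q)).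
Proof.
intros Hk Hq; unfold radq.
assert (HQ : q < sqrt (q ^ 2 + k ^ 2)).
{ rewrite <- (sqrt_pow2 q) at 1 by lra; apply sqrt_lt_1_alt; nra. }
assert (0 < sqrt (q ^ 2 + k ^ 2) / q - 1).
{ apply Rlt_0_minus, Rmult_lt_reg_r with q; [exact Hq|].
  unfold Rdiv; rewrite Rmult_assoc, Rinv_l by lra; lra. }
assert (0 < sqrt ((sqrt (q ^ 2 + k ^ 2) / q - 1) / 2)) by (apply sqrt_lt_R0; lra).
auto_derive.
- replace (q * (q * 1) + k * (k * 1)) with (q ^ 2 + k ^ 2) by ring.
  split; [nra|split; [|exact I]]; unfold Rdiv, Rminus in H; lra.
- replace (q * (q * 1) + k * (k * 1)) with (q ^ 2 + k ^ 2) by ring.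
  change ((sqrt (q ^ 2 + k ^ 2) * / q + - (1)) * / 2)
    with ((sqrt (q ^ 2 + k ^ 2) / q - 1) / 2).
  field; lra.
Qed.

(** First variation of area.  The main term is [k / 2] times the derivative
    in [k] of the translation up to [W].  The other one is a boundary term: it
    is there because the end angle is held fixed instead of the end radius,
    and it vanishes as [W] tends to [PI / 2].  The identity behind the
    computation is
    [(phi + psi) / cos w ^ 2 = psi + (phi * tan w)']. *)
Lemma is_derive_excess_angle (k W : R) : 0 < k -> 0 < W < PI / 2 ->
  is_derive (fun z => excess_angle z W) k
    (/ (2 * sqrt 2) * RInt (fun w => psi k (cos w)) 0 W
     + radq k (cos W) / (2 * sqrt (cos W ^ 2 + k ^ 2) * k)
       * (k * sin W - (sqrt (cos W ^ 2 + k ^ 2) + cos W))).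
Proof.
intros Hk HW.
assert (H2 : 0 < sqrt 2) by (apply sqrt_lt_R0; lra).
assert (Hcos : forall w, 0 <= w <= W -> 0 < cos w) by (intros; apply cos_gt_0; lra).
assert (Hc : forall w, Rmin 0 W <= w <= Rmax 0 W -> continuous (fun w => / cos w ^ 2) w).
{ rewrite Rmin_left, Rmax_right by lra; intros w Hw.
  specialize (Hcos w Hw).
  apply (ex_derive_continuous (fun w => / cos w ^ 2)).
  auto_derive; apply Rgt_not_eq; nra. }
assert (Hphi : forall w, Rmin 0 W <= w <= Rmax 0 W ->
          continuous (fun w => phi k (cos w) * / cos w ^ 2) w).
{ intros w Hw; apply (continuous_mult (fun w => phi k (cos w)) (fun w => / cos w ^ 2)).
  - apply continuous_phi, Hk.
  - apply Hc, Hw. }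
assert (Hpsi : forall w, Rmin 0 W <= w <= Rmax 0 W ->
          continuous (fun w => psi k (cos w) * / cos w ^ 2) w).
{ intros w Hw; apply (continuous_mult (fun w => psi k (cos w)) (fun w => / cos w ^ 2)).
  - apply continuous_psi, Hk.
  - apply Hc, Hw. }
assert (Iphi : ex_RInt (fun w => phi k (cos w) * / cos w ^ 2) 0 W)
  by (apply (@ex_RInt_continuous R_CompleteNormedModule); exact Hphi).
assert (Ipsi : ex_RInt (fun w => psi k (cos w) * / cos w ^ 2) 0 W)
  by (apply (@ex_RInt_continuous R_CompleteNormedModule); exact Hpsi).
(* The fundamental theorem applied to [phi * tan]. *)
assert (FTC : RInt (fun w => phi k (cos w) * / cos w ^ 2) 0 W
              + RInt (fun w => psi k (cos w) * / cos w ^ 2) 0 W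
              = RInt (fun w => psi k (cos w)) 0 W + phi k (cos W) * tan W).
{ assert (A : is_RInt (fun w => phi k (cos w) * / cos w ^ 2
                + (psi k (cos w) * / cos w ^ 2 - psi k (cos w))) 0 W
                (phi k (cos W) * tan W)).
  { replace (phi k (cos W) * tan W) with
      (minus (phi k (cos W) * tan W) (phi k (cos 0) * tan 0))
      by (rewrite tan_0; unfold minus, plus, opp; simpl; ring).
    apply (is_RInt_derive (fun w => phi k (cos w) * tan w)).
    - rewrite Rmin_left, Rmax_right by lra; intros w Hw.
      specialize (Hcos w Hw).
      assert (T := sin2_cos2 w); unfold Rsqr in T.
      evar_last.
      + apply (is_derive_mult (fun w => phi k (cos w)) tan).
        * apply is_derive_phi_w; assumption.
        * unfold tan; auto_derive; [lra|reflexivity].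
        * intros; apply Rmult_comm.
      + unfold plus, mult; simpl; unfold tan.
        field_simplify_eq; [|lra].
        replace (sin w ^ 2) with (1 - cos w ^ 2) by nra.
        ring.
    - intros w Hw.
      apply (continuous_plus (fun w => phi k (cos w) * / cos w ^ 2)
               (fun w => psi k (cos w) * / cos w ^ 2 - psi k (cos w))).
      + apply Hphi, Hw.
      + apply (continuous_minus (fun w => psi k (cos w) * / cos w ^ 2)
                 (fun w => psi k (cos w))).
        * apply Hpsi, Hw.
        * apply continuous_psi, Hk. }
  assert (B : is_RInt (fun w => phi k (cos w) * / cos w ^ 2
                + (psi k (cos w) * / cos w ^ 2 - psi k (cos w))) 0 W
         (plus (RInt (fun w => phi k (cos w) * / cos w ^ 2) 0 W)
            (minus (RInt (fun w => psi k (cos w) * / cos w ^ 2) 0 W)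
               (RInt (fun w => psi k (cos w)) 0 W)))).
  { apply (is_RInt_plus (fun w => phi k (cos w) * / cos w ^ 2)
             (fun w => psi k (cos w) * / cos w ^ 2 - psi k (cos w))).
    - apply (@RInt_correct R_CompleteNormedModule), Iphi.
    - apply (is_RInt_minus (fun w => psi k (cos w) * / cos w ^ 2)
               (fun w => psi k (cos w)));
      apply (@RInt_correct R_CompleteNormedModule); [exact Ipsi|].
      apply ex_RInt_psi, Hk. }
  apply (@is_RInt_unique R_CompleteNormedModule) in A.
  apply (@is_RInt_unique R_CompleteNormedModule) in B.
  rewrite A in B.
  change (phi k (cos W) * tan W = RInt (fun w => phi k (cos w) * / cos w ^ 2) 0 W
            + (RInt (fun w => psi k (cos w) * / cos w ^ 2) 0 W
               - RInt (fun w => psi k (cos w)) 0 W)) in B.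
  lra. }
assert (D1 := is_derive_RInt_phi (fun w => / cos w ^ 2) W k Hk Hc); cbv beta in D1.
assert (Hq := Hcos W ltac:(lra)).
assert (D2 := is_derive_radq k (cos W) Hk Hq).
assert (E1 : RInt (fun w => psi k (cos w) / k * / cos w ^ 2) 0 W
             = / k * RInt (fun w => psi k (cos w) * / cos w ^ 2) 0 W).
{ rewrite <- RInt_scal_R by exact Ipsi.
  apply RInt_ext; intros w; rewrite Rmin_left, Rmax_right by lra; intros Hw.
  assert (0 < cos w) by (apply Hcos; lra).
  simpl; field; lra. }
rewrite E1 in D1.
set (I1 := RInt (fun w => phi k (cos w) * / cos w ^ 2) 0 W) in *.
set (I2 := RInt (fun w => psi k (cos w) * / cos w ^ 2) 0 W) in *.
set (I3 := RInt (fun w => psi k (cos w)) 0 W) in *.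
unfold excess_angle; evar_last.
- apply (is_derive_minus
    (fun z => z / (2 * sqrt 2) * RInt (fun w => phi z (cos w) * / cos w ^ 2) 0 W)
    (fun z => radq z (cos W))); [|exact D2].
  apply (is_derive_mult (fun z => z / (2 * sqrt 2))
    (fun z => RInt (fun w => phi z (cos w) * / cos w ^ 2) 0 W));
    [auto_derive; [exact I|reflexivity]|exact D1|intros; apply Rmult_comm].
- unfold minus, plus, opp, mult; simpl.
  change (RInt (fun w => phi k (cos w) * / (cos w * (cos w * 1))) 0 W) with I1.
  replace (cos W * (cos W * 1) + k * (k * 1)) with (cos W ^ 2 + k ^ 2) by ring.
  set (q := cos W) in *.
  assert (HQ : q < sqrt (q ^ 2 + k ^ 2)).
  { rewrite <- (sqrt_pow2 q) at 1 by lra; apply sqrt_lt_1_alt; nra. }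
  assert (SQ : sqrt (q ^ 2 + k ^ 2) ^ 2 = q ^ 2 + k ^ 2) by (apply pow2_sqrt; nra).
  assert (Hr1 : 0 < (sqrt (q ^ 2 + k ^ 2) / q - 1) / 2).
  { replace ((sqrt (q ^ 2 + k ^ 2) / q - 1) / 2)
      with ((sqrt (q ^ 2 + k ^ 2) - q) / (2 * q)) by (field; lra).
    apply Rdiv_lt_0_compat; lra. }
  assert (Hr : 0 < radq k q) by (apply sqrt_lt_R0, Hr1).
  assert (Sr : radq k q ^ 2 = (sqrt (q ^ 2 + k ^ 2) / q - 1) / 2)
    by (apply pow2_sqrt; lra).
  (* Both boundary contributions are expressed through the radius. *)
  assert (Ephi : phi k q = sqrt 2 * q * radq k q / sqrt (q ^ 2 + k ^ 2)).
  { unfold phi, beta.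
    rewrite <- (sqrt_pow2 (sqrt 2 * q * radq k q / sqrt (q ^ 2 + k ^ 2))).
    - f_equal; unfold Rdiv; rewrite !Rpow_mult_distr, Sr, (pow2_sqrt 2) by lra.
      field; lra.
    - left; apply Rdiv_lt_0_compat; [|lra].
      apply Rmult_lt_0_compat; [nra|exact Hr]. }
  set (Q := sqrt (q ^ 2 + k ^ 2)) in *.
  transitivity (/ (2 * sqrt 2) * (I1 + I2) - k / (4 * q * Q * radq k q));
    [field; lra|].
  rewrite FTC, Ephi.
  unfold tan; fold q.
  apply Rmult_eq_reg_r with (4 * q * Q * radq k q * k);
    [|apply Rgt_not_eq; repeat apply Rmult_lt_0_compat; lra].
  replace ((/ (2 * sqrt 2) * (I3 + sqrt 2 * q * radq k q / Q * (sin W / q))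
            - k / (4 * q * Q * radq k q)) * (4 * q * Q * radq k q * k))
    with (/ (2 * sqrt 2) * I3 * (4 * q * Q * radq k q * k)
          + (2 * q * k * sin W * radq k q ^ 2 - k ^ 2)) by (field; lra).
  replace ((/ (2 * sqrt 2) * I3 + radq k q / (2 * Q * k) * (k * sin W - (Q + q)))
            * (4 * q * Q * radq k q * k))
    with (/ (2 * sqrt 2) * I3 * (4 * q * Q * radq k q * k)
          + 2 * q * radq k q ^ 2 * (k * sin W - (Q + q))) by (field; lra).
  rewrite Sr.
  replace (k ^ 2) with (Q ^ 2 - q ^ 2) by lra.
  field; lra.
Qed.

Lemma RInt_psi_tail (k W : R) : 0 < k -> W <= PI / 2 ->
  Rabs (RInt (fun w => psi k (cos w)) 0 W - slope k) <= PI / 2 - W.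
Proof.
intros Hk HW; unfold slope.
rewrite <- (RInt_Chasles (fun w => psi k (cos w)) 0 W (PI / 2)) by (apply ex_RInt_psi, Hk).
unfold plus; simpl.
match goal with |- Rabs ?x <= _ =>
  replace x with (- RInt (fun w => psi k (cos w)) W (PI / 2)) by ring end.
rewrite Rabs_Ropp, <- (Rmult_1_r (PI / 2 - W)).
apply (norm_RInt_le_const (fun w => psi k (cos w)) W (PI / 2)
         (RInt (fun w => psi k (cos w)) W (PI / 2)) 1 HW).
- intros w _; apply Rabs_le; assert (B := psi_bounds k (cos w) Hk); lra.
- apply (@RInt_correct R_CompleteNormedModule), ex_RInt_psi, Hk.
Qed.

(** With [q = cos W] and [Q = sqrt (q ^ 2 + k ^ 2)], the bracket is of order
    [q] and [radq k q] is of order [/ sqrt q]; the bound is uniform for [k] in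
    [[k1, k2]]. *)
Lemma flux_error (k1 k2 k W : R) : 0 < k1 -> k1 <= k <= k2 -> 0 < W < PI / 2 ->
  Rabs (radq k (cos W) / (2 * sqrt (cos W ^ 2 + k ^ 2) * k)
        * (k * sin W - (sqrt (cos W ^ 2 + k ^ 2) + cos W)))
  <= (2 + k2) * sqrt k2 / k1 ^ 2 * sqrt (cos W).
Proof.
intros H1 Hk HW.
assert (Hq := cos_bounds W HW).
assert (Hs : 0 < sin W) by (apply sin_gt_0; lra).
assert (T := sin2_cos2 W); unfold Rsqr in T.
set (q := cos W) in *.
assert (SQ : sqrt (q ^ 2 + k ^ 2) ^ 2 = q ^ 2 + k ^ 2) by (apply pow2_sqrt; nra).
assert (P := hyp_pos k q ltac:(lra)).
set (Q := sqrt (q ^ 2 + k ^ 2)) in *.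
assert (Q1 : k <= Q) by nra.
assert (Q2 : q <= Q) by nra.
assert (Q3 : Q <= q + k) by nra.
assert (Hr1 : (Q / q - 1) / 2 = (Q - q) / (2 * q)) by (field; lra).
assert (Hr0 : 0 <= (Q - q) / (2 * q))
  by (apply Rmult_le_pos; [lra|left; apply Rinv_0_lt_compat; lra]).
assert (R0 : 0 <= radq k q) by apply sqrt_pos.
assert (Rq : radq k q * q <= sqrt k2 * sqrt q).
{ rewrite <- sqrt_mult_alt by lra.
  rewrite <- (sqrt_pow2 (radq k q * q)) by nra.
  apply sqrt_le_1_alt; rewrite Rpow_mult_distr.
  unfold radq; fold Q; rewrite Hr1, pow2_sqrt by exact Hr0.
  replace ((Q - q) / (2 * q) * q ^ 2) with ((Q - q) * q / 2) by (field; lra).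
  nra. }
assert (B : Rabs (k * sin W - (Q + q)) <= (2 + k2) * q).
(* [k * sin W] and [Q] both differ from [k] by at most a multiple of [q]. *)
{ assert (S1 : 1 - q <= sin W <= 1) by (split; nra).
  assert (S2 : k * (1 - q) <= k * sin W <= k * 1)
    by (split; apply Rmult_le_compat_l; lra).
  apply Rabs_le; split; nra. }
assert (C : 0 < / (2 * Q * k) <= / k1 ^ 2).
{ split; [apply Rinv_0_lt_compat; nra|apply Rinv_le_contravar; [|]; nra]. }
rewrite Rabs_mult, (Rabs_pos_eq (radq k q / (2 * Q * k)))
  by (apply Rmult_le_pos; [exact R0|lra]).
apply Rle_trans with (radq k q / (2 * Q * k) * ((2 + k2) * q)).
- apply Rmult_le_compat_l; [apply Rmult_le_pos; lra|exact B].
- replace (radq k q / (2 * Q * k) * ((2 + k2) * q))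
    with ((2 + k2) * ((radq k q * q) * / (2 * Q * k))) by (unfold Rdiv; ring).
  replace ((2 + k2) * sqrt k2 / k1 ^ 2 * sqrt q)
    with ((2 + k2) * ((sqrt k2 * sqrt q) * / k1 ^ 2)) by (unfold Rdiv; ring).
  apply Rmult_le_compat_l; [lra|].
  apply Rmult_le_compat; [nra|lra|exact Rq|lra].
Qed.

(** The mean value theorem in [k], with the end angle [atan Y].  The error
    is uniform in [k], so signs of [slope] survive the limit in [Y]. *)
Lemma excess_angle_mean_value (k1 k2 : R) : 0 < k1 < k2 ->
  exists A, forall Y, 1 <= Y -> exists k,
    k1 < k < k2 /\
    Rabs ((excess_angle k2 (atan Y) - excess_angle k1 (atan Y)) 
           - (k2 - k1) * (/ (2 * sqrt 2) * slope k)) <= A * / sqrt Y.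
Proof.
intros H12.
assert (H2 : 1 <= sqrt 2) by (rewrite <- sqrt_1 at 1; apply sqrt_le_1_alt; lra).
exists ((k2 - k1) * (1 + (2 + k2) * sqrt k2 / k1 ^ 2)); intros Y HY.
assert (HW : 0 < atan Y < PI / 2).
{ split; [rewrite <- atan_0; apply atan_increasing; lra|apply atan_bound]. }
set (W := atan Y) in *.
destruct (MVT_cor2 (fun z => excess_angle z W)
  (fun k => / (2 * sqrt 2) * RInt (fun w => psi k (cos w)) 0 W
     + radq k (cos W) / (2 * sqrt (cos W ^ 2 + k ^ 2) * k)
       * (k * sin W - (sqrt (cos W ^ 2 + k ^ 2) + cos W))) k1 k2) as [k [E Hk]].
- lra.
- intros k Hk; apply is_derive_Reals, is_derive_excess_angle; lra.
- exists k; split; [exact Hk|].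
  rewrite E.
  assert (B1 := flux_error k1 k2 k W ltac:(lra) ltac:(lra) HW).
  assert (B2 := RInt_psi_tail k W ltac:(lra) ltac:(lra)).
  assert (SY : 1 <= sqrt Y) by (rewrite <- sqrt_1 at 1; apply sqrt_le_1_alt; lra).
  assert (SY2 := pow2_sqrt Y ltac:(lra)).
  assert (B3 : PI / 2 - W <= / sqrt Y).
  { apply Rle_trans with (/ Y); [apply PI2_minus_atan; lra|].
    apply Rinv_le_contravar; nra. }
  assert (B4 : sqrt (cos W) <= / sqrt Y).
  { rewrite <- sqrt_inv; apply sqrt_le_1_alt.
    unfold W; rewrite cos_atan; unfold Rdiv; rewrite Rmult_1_l.
    apply Rinv_le_contravar; [lra|].
    rewrite <- (sqrt_pow2 Y) at 1 by lra.
    apply sqrt_le_1_alt; unfold Rsqr; nra. }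
  set (e := radq k (cos W) / (2 * sqrt (cos W ^ 2 + k ^ 2) * k)
       * (k * sin W - (sqrt (cos W ^ 2 + k ^ 2) + cos W))) in *.
  set (t := RInt (fun w => psi k (cos w)) 0 W) in *.
  replace ((/ (2 * sqrt 2) * t + e) * (k2 - k1)
           - (k2 - k1) * (/ (2 * sqrt 2) * slope k))
    with ((k2 - k1) * (/ (2 * sqrt 2) * (t - slope k) + e)) by ring.
  rewrite Rabs_mult, (Rabs_pos_eq (k2 - k1)), Rmult_assoc by lra.
  apply Rmult_le_compat_l; [lra|].
  apply Rle_trans with (1 := Rabs_triang _ _).
  rewrite Rmult_plus_distr_r; apply Rplus_le_compat.
  + rewrite Rabs_mult, Rabs_pos_eq by (left; apply Rinv_0_lt_compat; lra).
    apply Rmult_le_compat; [left; apply Rinv_0_lt_compat; lra|apply Rabs_pos| |lra].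
    rewrite <- Rinv_1; apply Rinv_le_contravar; lra.
  + apply Rle_trans with (1 := B1).
    apply Rmult_le_compat_l; [|exact B4].
    apply Rmult_le_pos; [|left; apply Rinv_0_lt_compat; nra].
    assert (X := sqrt_pos k2); nra.
Qed.

(** The relation [d limit_excess = (k / 2) d halfsep] in integrated form:
    only the sign of [slope] inside the interval matters. *)
Lemma limit_excess_mono (k1 k2 : R) : 0 < k1 < k2 ->
  ((forall k, k1 < k < k2 -> 0 <= slope k) -> limit_excess k1 <= limit_excess k2)
  /\ ((forall k, k1 < k < k2 -> slope k <= 0) -> limit_excess k2 <= limit_excess k1).
Proof.
intros H12.
assert (H2 : 0 < / (2 * sqrt 2))
  by (apply Rinv_0_lt_compat; assert (X := sqrt_lt_R0 2 Rlt_0_2); lra).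
destruct (excess_angle_mean_value k1 k2 H12) as [A HA].
assert (L1 := is_lim_excess_angle k1 ltac:(lra)).
assert (L2 := is_lim_excess_angle k2 ltac:(lra)).
assert (L0 := is_lim_inv_sqrt A).
assert (Loc : Rbar_locally' p_infty (fun Y => 1 <= Y)) by (exists 1; intros; lra).
split; intros Hs.
- assert (L : is_lim (fun Y => excess_angle k1 (atan Y) - A * / sqrt Y) p_infty
                (limit_excess k1 - 0)) by (apply is_lim_minus'; assumption).
  rewrite Rminus_0_r in L.
  refine (is_lim_le_loc _ _ p_infty (limit_excess k1) (limit_excess k2) _ L L2).
  apply filter_imp with (2 := Loc); intros Y HY.
  destruct (HA Y HY) as [k [Hk B]]; apply Rabs_le_between in B.
  assert (S := Hs k Hk).
  assert (0 <= (k2 - k1) * (/ (2 * sqrt 2) * slope k))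
    by (apply Rmult_le_pos; [lra|apply Rmult_le_pos; lra]).
  lra.
- assert (L : is_lim (fun Y => excess_angle k1 (atan Y) + A * / sqrt Y) p_infty
                (limit_excess k1 + 0)) by (apply is_lim_plus'; assumption).
  rewrite Rplus_0_r in L.
  refine (is_lim_le_loc _ _ p_infty (limit_excess k2) (limit_excess k1) _ L2 L).
  apply filter_imp with (2 := Loc); intros Y HY.
  destruct (HA Y HY) as [k [Hk B]]; apply Rabs_le_between in B.
  assert (S := Hs k Hk).
  assert (0 <= (k2 - k1) * (/ (2 * sqrt 2) * - slope k))
    by (apply Rmult_le_pos; [lra|apply Rmult_le_pos; lra]).
  lra.
Qed.

(** * The catenoids in the normalized parameter *)

(** In this parameter the neck has radius [a] with
    [sinh (2 a) = modulus c]. *)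
Definition modulus (c : R) : R := 2 / c ^ 2.

(** Hyperbolic translation along the axis from the neck to the point of
    parameter [s]. *)
Definition axial (k s : R) : R := RInt (speed k) 0 s.

Lemma modulus_gt_0 (c : R) : 0 < c -> 0 < modulus c.
Proof. intros Hc; apply Rdiv_lt_0_compat; [lra|nra]. Qed.

Lemma cat_u_eq (c s : R) : 0 < c ->
  cat_u c s = modulus c / (2 * rad (modulus c) s ^ 2).
Proof.
intros Hc; assert (Hk := modulus_gt_0 c Hc).
rewrite rad_sqr by exact Hk.
assert (Hx := cosh2r_gt_1 (modulus c) s Hk).
assert (E : sqrt (c ^ 4 + 4) = c ^ 2 * sqrt (1 + modulus c ^ 2)).
{ rewrite <- (sqrt_pow2 (c ^ 2)) by nra.
  rewrite <- sqrt_mult_alt by nra.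
  f_equal; unfold modulus; field; lra. }
unfold cat_u; rewrite E.
replace (c ^ 2 * sqrt (1 + modulus c ^ 2) * cosh (2 * s) - c ^ 2)
  with (c ^ 2 * (cosh2r (modulus c) s - 1)) by (unfold cosh2r; ring).
unfold modulus at 2; field; lra.
Qed.

Lemma sqrt_cat_u (c s : R) : 0 < c -> c * sqrt (cat_u c s) = / rad (modulus c) s.
Proof.
intros Hc; assert (Hk := modulus_gt_0 c Hc).
assert (Hr := rad_gt_0 (modulus c) s Hk).
rewrite cat_u_eq by exact Hc.
rewrite <- (sqrt_pow2 c) at 1 by lra.
rewrite <- sqrt_mult_alt by nra.
rewrite <- (sqrt_pow2 (/ rad (modulus c) s))
  by (left; apply Rinv_0_lt_compat, Hr).
f_equal; unfold modulus at 1; field; lra.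
Qed.

Lemma rho_rad (k s : R) : 0 < k -> rho k s ^ 2 = 1 + rad k s ^ 2.
Proof. intros Hk; rewrite rho_sqr, rad_sqr by exact Hk; field. Qed.

Lemma sqrt_one_plus_cat_u (c s : R) : 0 < c ->
  sqrt (1 + c ^ 2 * cat_u c s) = rho (modulus c) s / rad (modulus c) s.
Proof.
intros Hc; assert (Hk := modulus_gt_0 c Hc).
assert (Hr := rad_gt_0 (modulus c) s Hk).
assert (Ho := rho_gt_0 (modulus c) s Hk).
rewrite <- (sqrt_pow2 (rho (modulus c) s / rad (modulus c) s))
  by (left; apply Rdiv_lt_0_compat; assumption).
f_equal.
unfold Rdiv; rewrite Rpow_mult_distr, rho_rad, cat_u_eq by assumption.
unfold modulus at 1; field; lra.
Qed.

Lemma cat_v_eq (c s : R) : 0 < c -> cat_v c s = - axial (modulus c) s.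
Proof.
intros Hc; assert (Hk := modulus_gt_0 c Hc).
unfold cat_v, axial.
assert (E : forall r, Rpower (cat_u c r) (3 / 2) / (1 + c ^ 2 * cat_u c r)
                      = / c * speed (modulus c) r).
{ intros r; assert (Hr := rad_gt_0 (modulus c) r Hk).
  assert (Hu : 0 < cat_u c r).
  { rewrite cat_u_eq by exact Hc; apply Rdiv_lt_0_compat; nra. }
  replace (3 / 2) with (1 + / 2) by field.
  rewrite Rpower_plus, Rpower_1, Rpower_sqrt by exact Hu.
  replace (sqrt (cat_u c r)) with (/ c * / rad (modulus c) r)
    by (rewrite <- sqrt_cat_u by exact Hc; field; lra).
  unfold speed; rewrite rho_rad, cat_u_eq by assumption.
  replace (c ^ 2 * (modulus c / (2 * rad (modulus c) r ^ 2)))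
    with (/ rad (modulus c) r ^ 2) by (unfold modulus at 2; field; lra).
  field; repeat split; try lra; nra. }
rewrite (RInt_ext _ (fun r => / c * speed (modulus c) r)) by (intros; apply E).
rewrite RInt_scal_R by (apply ex_RInt_speed, Hk).
field; lra.
Qed.

Lemma catenoid_eq (c s t : R) : 0 < c ->
  catenoid c s t =
  (rad (modulus c) s * cos t, rad (modulus c) s * sin t,
   - (rho (modulus c) s * sinh (axial (modulus c) s)),
   rho (modulus c) s * cosh (axial (modulus c) s)).
Proof.
intros Hc; assert (Hk := modulus_gt_0 c Hc).
assert (Hr := rad_gt_0 (modulus c) s Hk).
unfold catenoid; cbv zeta.
rewrite sqrt_cat_u, sqrt_one_plus_cat_u, cat_v_eq, sinh_opp, cosh_opp by exact Hc.
apply f_equal2; [apply f_equal2; [apply f_equal2|]|]; field; lra.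
Qed.

Lemma is_derive_axial (k s : R) : 0 < k -> is_derive (axial k) s (speed k s).
Proof.
intros Hk; unfold axial.
apply (is_derive_RInt (speed k) (RInt (speed k) 0) 0); [|apply continuous_speed, Hk].
apply filter_forall; intros; apply (@RInt_correct R_CompleteNormedModule), ex_RInt_speed, Hk.
Qed.

Lemma speed_gt_0 (k s : R) : 0 < k -> 0 < speed k s.
Proof.
intros Hk; assert (Hr := rad_gt_0 k s Hk); assert (Ho := rho_gt_0 k s Hk).
apply Rdiv_lt_0_compat; [exact Hk|].
apply Rmult_lt_0_compat; [|exact Hr].
assert (0 < rho k s ^ 2) by (apply pow_lt, Ho); lra.
Qed.

(** Since [s] is arc length on the generating curve, the area element is
    the radius of the circle of rotation. *)
Lemma area_element_catenoid (c s t : R) : 0 < c ->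
  area_element (catenoid c) s t = rad (modulus c) s.
Proof.
intros Hc; assert (Hk := modulus_gt_0 c Hc).
unfold area_element, curve_deriv; cbv zeta.
set (k := modulus c) in *.
assert (Hr := rad_gt_0 k s Hk); assert (Ho := rho_gt_0 k s Hk).
set (B := sqrt (1 + k ^ 2) * sinh (2 * s)).
set (r' := B / (2 * rad k s)).
set (o' := B / (2 * rho k s)).
assert (Dr := is_derive_rad k s Hk); fold B in Dr; fold r' in Dr.
assert (Do := is_derive_rho k s Hk); fold B in Do; fold o' in Do.
assert (Dd := is_derive_axial k s Hk).
assert (DS : is_derive (fun r => sinh (axial k r)) s (speed k s * cosh (axial k s)))
  by (apply (is_derive_comp sinh (axial k)); [apply is_derive_sinh|exact Dd]).
assert (DC : is_derive (fun r => cosh (axial k r)) s (speed k s * sinh (axial k s)))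
  by (apply (is_derive_comp cosh (axial k)); [apply is_derive_cosh|exact Dd]).
assert (E1 : Derive (fun r => px1 (catenoid c r t)) s = r' * cos t).
{ apply is_derive_unique.
  apply (is_derive_ext (fun r => rad k r * cos t));
    [intros; rewrite catenoid_eq by exact Hc; reflexivity|].
  apply (is_derive_scal_l (rad k) s r' (cos t) Dr). }
assert (E2 : Derive (fun r => px2 (catenoid c r t)) s = r' * sin t).
{ apply is_derive_unique.
  apply (is_derive_ext (fun r => rad k r * sin t));
    [intros; rewrite catenoid_eq by exact Hc; reflexivity|].
  apply (is_derive_scal_l (rad k) s r' (sin t) Dr). }
assert (E3 : Derive (fun r => px3 (catenoid c r t)) s
             = - (o' * sinh (axial k s) + rho k s * (speed k s * cosh (axial k s)))).
{ apply is_derive_unique.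
  apply (is_derive_ext (fun r => - (rho k r * sinh (axial k r))));
    [intros; rewrite catenoid_eq by exact Hc; reflexivity|].
  apply (is_derive_opp (fun r => rho k r * sinh (axial k r))).
  apply (is_derive_mult (rho k) (fun r => sinh (axial k r)) s o' _ Do DS).
  intros; apply Rmult_comm. }
assert (E4 : Derive (fun r => pz (catenoid c r t)) s
             = o' * cosh (axial k s) + rho k s * (speed k s * sinh (axial k s))).
{ apply is_derive_unique.
  apply (is_derive_ext (fun r => rho k r * cosh (axial k r)));
    [intros; rewrite catenoid_eq by exact Hc; reflexivity|].
  apply (is_derive_mult (rho k) (fun r => cosh (axial k r)) s o' _ Do DC).
  intros; apply Rmult_comm. }
assert (F1 : Derive (fun r => px1 (catenoid c s r)) t = - (rad k s * sin t)).
{ apply is_derive_unique.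
  apply (is_derive_ext (fun r => rad k s * cos r));
    [intros; rewrite catenoid_eq by exact Hc; reflexivity|].
  auto_derive; [exact I|ring]. }
assert (F2 : Derive (fun r => px2 (catenoid c s r)) t = rad k s * cos t).
{ apply is_derive_unique.
  apply (is_derive_ext (fun r => rad k s * sin r));
    [intros; rewrite catenoid_eq by exact Hc; reflexivity|].
  auto_derive; [exact I|ring]. }
assert (F3 : Derive (fun r => px3 (catenoid c s r)) t = 0).
{ apply is_derive_unique.
  apply (is_derive_ext (fun _ => - (rho k s * sinh (axial k s))));
    [intros; rewrite catenoid_eq by exact Hc; reflexivity|].
  apply @is_derive_const. }
assert (F4 : Derive (fun r => pz (catenoid c s r)) t = 0).
{ apply is_derive_unique.
  apply (is_derive_ext (fun _ => rho k s * cosh (axial k s)));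
    [intros; rewrite catenoid_eq by exact Hc; reflexivity|].
  apply @is_derive_const. }
rewrite E1, E2, E3, E4, F1, F2, F3, F4.
unfold lorentz, px1, px2, px3, pz; simpl fst; simpl snd.
assert (T := sin2_cos2 t); unfold Rsqr in T.
assert (H := cosh_sqr (axial k s)).
(* Unit speed. *)
assert (G : r' ^ 2 - o' ^ 2 + (rho k s * speed k s) ^ 2 = 1).
{ unfold r', o', speed.
  assert (Ex := cosh2r_sqr k s); fold B in Ex.
  assert (R2 := rad_sqr k s Hk); assert (O2 := rho_sqr k s Hk).
  replace ((B / (2 * rad k s)) ^ 2 - (B / (2 * rho k s)) ^ 2
           + (rho k s * (k / (2 * rho k s ^ 2 * rad k s))) ^ 2)
    with ((B ^ 2 * (rho k s ^ 2 - rad k s ^ 2) + k ^ 2)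
          / (4 * (rad k s ^ 2 * rho k s ^ 2))) by (field; lra).
  rewrite R2, O2.
  assert (Hx := cosh2r_gt_1 k s Hk).
  replace (B ^ 2) with (cosh2r k s ^ 2 - 1 - k ^ 2) by lra.
  field; nra. }
transitivity (sqrt (rad k s ^ 2)); [f_equal|apply sqrt_pow2; lra].
set (S := sinh (axial k s)) in *; set (C := cosh (axial k s)) in *.
transitivity ((r' ^ 2 * (sin t * sin t + cos t * cos t)
    + (rho k s * speed k s) ^ 2 * (C ^ 2 - S ^ 2) - o' ^ 2 * (C ^ 2 - S ^ 2))
    * (rad k s ^ 2 * (sin t * sin t + cos t * cos t))); [ring|].
rewrite T, H; replace (1 + S ^ 2 - S ^ 2) with 1 by ring.
replace (r' ^ 2 * 1 + (rho k s * speed k s) ^ 2 * 1 - o' ^ 2 * 1) with 1 by lra.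
ring.
Qed.

(** * Translation along the axis *)

Lemma cosh2r_even (k s : R) : cosh2r k (- s) = cosh2r k s.
Proof. unfold cosh2r; rewrite <- cosh_opp; do 2 f_equal; ring. Qed.

Lemma rad_even (k s : R) : rad k (- s) = rad k s.
Proof. unfold rad; rewrite cosh2r_even; reflexivity. Qed.

Lemma rho_even (k s : R) : rho k (- s) = rho k s.
Proof. unfold rho; rewrite cosh2r_even; reflexivity. Qed.

Lemma axial_odd (k s : R) : 0 < k -> axial k (- s) = - axial k s.
Proof.
intros Hk; apply RInt_even.
- intros x; unfold speed; rewrite rad_even, rho_even; reflexivity.
- intros; apply ex_RInt_speed, Hk.
Qed.

Lemma axial_ge_0 (k s : R) : 0 < k -> 0 <= s -> 0 <= axial k s.
Proof.
intros Hk Hs; apply RInt_ge_0; [exact Hs|apply ex_RInt_speed, Hk|].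
intros; left; apply speed_gt_0, Hk.
Qed.

Lemma halfsep_minus_axial (k s : R) : 0 < k ->
  halfsep k - axial k s = / sqrt 2 * RInt (fun w => phi k (cos w)) (angle k s) (PI / 2).
Proof.
intros Hk; unfold halfsep, axial; rewrite RInt_speed_angle by exact Hk.
rewrite <- (RInt_Chasles (fun w => phi k (cos w)) 0 (angle k s) (PI / 2))
  by (apply ex_RInt_phi, Hk).
unfold plus; simpl; ring.
Qed.

Lemma axial_le_halfsep (k s : R) : 0 < k -> axial k s <= halfsep k.
Proof.
intros Hk; assert (E := halfsep_minus_axial k s Hk).
assert (B := atan_bound (sqrt (1 + k ^ 2) * sinh (2 * s) / k)).
fold (angle k s) in B.
assert (0 < / sqrt 2) by (apply Rinv_0_lt_compat, sqrt_lt_R0; lra).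
assert (0 <= RInt (fun w => phi k (cos w)) (angle k s) (PI / 2)); [|nra].
apply RInt_ge_0; [lra|apply ex_RInt_phi, Hk|intros; apply sqrt_pos].
Qed.

Lemma halfsep_axial_gap (k s : R) : 0 < k -> 1 <= s ->
  halfsep k - axial k s <= 4 * k * exp (- (2 * s)).
Proof.
intros Hk Hs; rewrite halfsep_minus_axial by exact Hk.
assert (H1 := cosh_neck_gt_1 k Hk).
assert (Hsh : exp (2 * s) / 4 <= sinh (2 * s)).
{ unfold sinh.
  assert (A := exp_ineq1 (2 * s) ltac:(lra)).
  assert (M : exp (2 * s) * exp (- (2 * s)) = 1)
    by (rewrite <- exp_plus, Rplus_opp_r; apply exp_0).
  assert (P := exp_pos (- (2 * s))); nra. }
assert (He := exp_pos (2 * s)).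
set (y := sqrt (1 + k ^ 2) * sinh (2 * s) / k).
assert (Hy : exp (2 * s) / (4 * k) <= y).
{ unfold y; replace (exp (2 * s) / (4 * k)) with (exp (2 * s) / 4 * / k) by (field; lra).
  apply Rmult_le_compat_r; [left; apply Rinv_0_lt_compat, Hk|nra]. }
assert (Hy0 : 0 < exp (2 * s) / (4 * k)) by (apply Rdiv_lt_0_compat; lra).
assert (G : PI / 2 - angle k s <= 4 * k * exp (- (2 * s))).
{ unfold angle; fold y; apply Rle_trans with (/ y); [apply PI2_minus_atan; lra|].
  rewrite exp_Ropp.
  replace (4 * k * / exp (2 * s)) with (/ (exp (2 * s) / (4 * k))) by (field; lra).
  apply Rinv_le_contravar; lra. }
assert (B := atan_bound y); fold (angle k s) in B.
assert (H2 : 1 <= sqrt 2) by (rewrite <- sqrt_1 at 1; apply sqrt_le_1_alt; lra).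
assert (H3 : 0 < / sqrt 2 <= 1).
{ split; [apply Rinv_0_lt_compat; lra|].
  rewrite <- Rinv_1; apply Rinv_le_contravar; lra. }
apply Rle_trans with (2 := G).
assert (I0 : 0 <= RInt (fun w => phi k (cos w)) (angle k s) (PI / 2)).
{ apply RInt_ge_0; [unfold angle; fold y; lra|apply ex_RInt_phi, Hk|intros; apply sqrt_pos]. }
assert (I1 : Rabs (RInt (fun w => phi k (cos w)) (angle k s) (PI / 2)) <= (PI / 2 - angle k s) * 1).
{ apply (norm_RInt_le_const (fun w => phi k (cos w)) (angle k s) (PI / 2)).
  - unfold angle; fold y; lra.
  - intros w _; apply Rabs_le; assert (A := phi_le_half k (cos w)).
    assert (A' := sqrt_pos (beta k (cos w) * (1 - beta k (cos w)))).
    fold (phi k (cos w)) in A'; lra.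
  - apply (@RInt_correct R_CompleteNormedModule), ex_RInt_phi, Hk. }
rewrite Rabs_pos_eq in I1 by exact I0.
nra.
Qed.

Lemma is_lim_axial (k : R) : 0 < k -> is_lim (axial k) p_infty (halfsep k).
Proof.
intros Hk.
apply (is_lim_le_le_loc (fun s => halfsep k - 4 * k * exp (- s)) (fun _ => halfsep k)).
- exists 1; intros s Hs; split; [|apply axial_le_halfsep, Hk].
  assert (A := halfsep_axial_gap k s Hk ltac:(lra)).
  assert (exp (- (2 * s)) <= exp (- s)) by (left; apply exp_increasing; lra).
  assert (P := exp_pos (- s)); nra.
- evar_last; [apply is_lim_minus'; [apply is_lim_const|apply is_lim_exp_opp_scal]|].
  simpl; f_equal; ring.
- apply is_lim_const.
Qed.

(** * The height *)

Lemma Rabs_coord_le_edist (p q : R3) : Rabs (snd p - snd q) <= edist p q.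
Proof.
unfold edist; rewrite <- sqrt_Rsqr_abs; apply sqrt_le_1_alt; unfold Rsqr.
assert (A := pow2_ge_0 (fst (fst p) - fst (fst q))).
assert (B := pow2_ge_0 (snd (fst p) - snd (fst q))).
nra.
Qed.

Lemma edist_to_plane (p : R3) : edist_to (fun q => snd q = 0) p = Rabs (snd p).
Proof.
unfold edist_to; rewrite (is_glb_Rbar_unique _ (Rabs (snd p))); [reflexivity|].
split.
- intros d [q [Hq ->]]; simpl.
  assert (A := Rabs_coord_le_edist p q); rewrite Hq, Rminus_0_r in A; exact A.
- intros b Hb; apply Hb.
  exists (fst (fst p), snd (fst p), 0); split; [reflexivity|].
  unfold edist; simpl; rewrite <- sqrt_Rsqr_abs; f_equal; unfold Rsqr; ring.
Qed.

Lemma curve_height (c s : R) : 0 < c ->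
  Rabs (snd (poincare (catenoid c s 0)))
  = rho (modulus c) s * sinh (Rabs (axial (modulus c) s))
    / (1 + rho (modulus c) s * cosh (axial (modulus c) s)).
Proof.
intros Hc; assert (Hk := modulus_gt_0 c Hc).
rewrite catenoid_eq by exact Hc.
unfold poincare, px3, pz; simpl.
set (k := modulus c) in *; set (d := axial k s).
assert (Ho := rho_gt_0 k s Hk); assert (Cd := cosh_ge_1 d).
unfold Rdiv; rewrite Rabs_mult, Rabs_Ropp, Rabs_mult.
rewrite (Rabs_pos_eq (rho k s)), (Rabs_pos_eq (/ (1 + rho k s * cosh d)))
  by first [lra|left; apply Rinv_0_lt_compat; nra].
do 2 f_equal.
unfold Rabs at 2; destruct (Rcase_abs d) as [Hd|Hd].
- rewrite sinh_opp; apply Rabs_left; rewrite <- sinh_0; apply sinh_lt, Hd.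
- apply Rabs_pos_eq; destruct (Req_dec d 0) as [->|]; [rewrite sinh_0; lra|].
  left; rewrite <- sinh_0; apply sinh_lt; lra.
Qed.

(** Because [rho * sinh a / (1 + rho * cosh a) <= tanh a] for [0 <= a]. *)
Lemma curve_height_le (c s : R) : 0 < c ->
  Rabs (snd (poincare (catenoid c s 0))) <= tanh (halfsep (modulus c)).
Proof.
intros Hc; assert (Hk := modulus_gt_0 c Hc); rewrite curve_height by exact Hc.
set (k := modulus c) in *; set (d := axial k s).
assert (Ho := rho_gt_0 k s Hk); assert (Cd := cosh_ge_1 d).
assert (Ed : cosh d = cosh (Rabs d)).
{ unfold Rabs; destruct (Rcase_abs d); [rewrite cosh_opp|]; reflexivity. }
apply Rle_trans with (tanh (Rabs d)).
- unfold tanh; rewrite <- Ed.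
  assert (Sd : 0 <= sinh (Rabs d)).
  { assert (P := Rabs_pos d).
    destruct (Req_dec (Rabs d) 0) as [->|]; [rewrite sinh_0; lra|].
    left; rewrite <- sinh_0; apply sinh_lt; lra. }
  apply Rmult_le_reg_r with ((1 + rho k s * cosh d) * cosh d); [nra|].
  replace (rho k s * sinh (Rabs d) / (1 + rho k s * cosh d) * ((1 + rho k s * cosh d) * cosh d))
    with (rho k s * sinh (Rabs d) * cosh d) by (field; nra).
  replace (sinh (Rabs d) / cosh d * ((1 + rho k s * cosh d) * cosh d))
    with (sinh (Rabs d) * (1 + rho k s * cosh d)) by (field; lra).
  nra.
- apply tanh_le; unfold d.
  apply Rabs_le; split; [|apply axial_le_halfsep, Hk].
  assert (A := axial_le_halfsep k (- s) Hk); rewrite axial_odd in A by exact Hk; lra.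
Qed.

Lemma is_lim_inv_rad (k : R) : 0 < k -> is_lim (fun s => / rad k s) p_infty 0.
Proof.
intros Hk; assert (H1 := cosh_neck_gt_1 k Hk).
set (m := sqrt (sqrt (1 + k ^ 2) - 1) / 2).
assert (Hm : 0 < m) by (unfold m; apply Rdiv_lt_0_compat; [apply sqrt_lt_R0|]; lra).
apply (is_lim_le_le_loc (fun _ => 0) (fun s => / m * exp (- s))).
- exists 0; intros s _.
  assert (Hr := rad_gt_0 k s Hk); assert (Hl := rad_lower k s Hk); fold m in Hl.
  assert (He := exp_pos s).
  split; [left; apply Rinv_0_lt_compat, Hr|].
  rewrite exp_Ropp, <- Rinv_mult; apply Rinv_le_contravar; [nra|exact Hl].
- apply is_lim_const.
- apply is_lim_exp_opp_scal.
Qed.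

Lemma is_lim_inv_rho (k : R) : 0 < k -> is_lim (fun s => / rho k s) p_infty 0.
Proof.
intros Hk.
apply (is_lim_le_le_loc (fun _ => 0) (fun s => / rad k s)).
- exists 0; intros s _.
  assert (Hr := rad_gt_0 k s Hk); assert (Ho := rho_gt_0 k s Hk).
  split; [left; apply Rinv_0_lt_compat, Ho|].
  apply Rinv_le_contravar; [exact Hr|].
  apply sqrt_le_1_alt; lra.
- apply is_lim_const.
- apply is_lim_inv_rad, Hk.
Qed.

Lemma is_lim_curve_height (c : R) : 0 < c ->
  is_lim (fun s => Rabs (snd (poincare (catenoid c s 0)))) p_infty
    (tanh (halfsep (modulus c))).
Proof.
intros Hc; assert (Hk := modulus_gt_0 c Hc); set (k := modulus c) in *.
assert (L := is_lim_axial k Hk).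
assert (CV := cosh_ge_1 (halfsep k)).
apply is_lim_ext_loc with
  (fun s => sinh (axial k s) / (/ rho k s + cosh (axial k s))).
- exists 0; intros s Hs; rewrite curve_height by exact Hc; fold k.
  rewrite (Rabs_pos_eq (axial k s)) by (apply axial_ge_0; lra).
  assert (Ho := rho_gt_0 k s Hk); assert (Cd := cosh_ge_1 (axial k s)).
  field; split; nra.
- assert (EV : tanh (halfsep k) = sinh (halfsep k) / (0 + cosh (halfsep k)))
    by (unfold tanh; rewrite Rplus_0_l; reflexivity).
  rewrite EV.
  apply (is_lim_div _ _ p_infty (sinh (halfsep k)) (0 + cosh (halfsep k))).
  + apply is_lim_comp_cont; [apply continuous_sinh|exact L].
  + apply is_lim_plus'; [apply is_lim_inv_rho, Hk|].
    apply is_lim_comp_cont; [apply continuous_cosh|exact L].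
  + intros E; injection E; lra.
  + simpl; exact I.
Qed.

(** The closure adds nothing to the supremum since the height is
    1-Lipschitz, and the supremum is approached along the curve as [s] tends
    to infinity. *)
Lemma height_catenoid (c : R) : 0 < c -> height c = tanh (halfsep (modulus c)).
Proof.
intros Hc; unfold height.
rewrite (is_lub_Rbar_unique _ (tanh (halfsep (modulus c)))); [reflexivity|].
split.
- intros h [p [Hp ->]]; rewrite edist_to_plane; simpl.
  apply le_epsilon; intros e He.
  destruct (Hp e He) as [q [[s ->] Hq]].
  assert (A := curve_height_le c s Hc).
  assert (B := Rabs_coord_le_edist p (poincare (catenoid c s 0))).
  set (q := poincare (catenoid c s 0)) in *.
  replace (snd p) with (snd q + (snd p - snd q)) by ring.
  apply Rle_trans with (1 := Rabs_triang _ _); lra.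
- intros b Hb.
  assert (K : forall s, Rbar_le (Rabs (snd (poincare (catenoid c s 0)))) b).
  { intros s; apply Hb.
    exists (poincare (catenoid c s 0)); split; [|rewrite edist_to_plane; reflexivity].
    intros e He; exists (poincare (catenoid c s 0)); split; [exists s; reflexivity|].
    unfold edist; rewrite !Rminus_diag.
    replace (0 ^ 2 + 0 ^ 2 + 0 ^ 2) with 0 by ring; rewrite sqrt_0; exact He. }
  destruct b as [b| |]; [|exact I|apply (K 0)].
  apply (is_lim_le_loc (fun s => Rabs (snd (poincare (catenoid c s 0)))) (fun _ => b)
           p_infty (tanh (halfsep (modulus c))) b).
  + exists 0; intros s _; apply K.
  + apply is_lim_curve_height, Hc.
  + apply is_lim_const.
Qed.

(** * Area of the truncated catenoid *)

Definition zcoord (k s : R) : R := rho k s * cosh (axial k s).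

Lemma is_derive_zcoord (k s : R) : 0 < k ->
  is_derive (zcoord k) s
    (sqrt (1 + k ^ 2) * sinh (2 * s) / (2 * rho k s) * cosh (axial k s)
     + rho k s * (speed k s * sinh (axial k s))).
Proof.
intros Hk; unfold zcoord.
apply (is_derive_mult (rho k) (fun r => cosh (axial k r))).
- apply is_derive_rho, Hk.
- apply (is_derive_comp cosh (axial k)); [apply is_derive_cosh|apply is_derive_axial, Hk].
- intros; apply Rmult_comm.
Qed.

Lemma zcoord_incr (k a b : R) : 0 < k -> 0 <= a < b -> zcoord k a < zcoord k b.
Proof.
intros Hk Hab.
destruct (MVT_cor2 (zcoord k)
  (fun s => sqrt (1 + k ^ 2) * sinh (2 * s) / (2 * rho k s) * cosh (axial k s)
     + rho k s * (speed k s * sinh (axial k s))) a b) as [s [E Hs]].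
- lra.
- intros s _; apply is_derive_Reals, is_derive_zcoord, Hk.
- assert (H1 := cosh_neck_gt_1 k Hk); assert (Ho := rho_gt_0 k s Hk).
  assert (Hv := speed_gt_0 k s Hk); assert (Hc := cosh_ge_1 (axial k s)).
  assert (Hd := sinh_ge_0 _ (axial_ge_0 k s Hk ltac:(lra))).
  assert (0 < sinh (2 * s)) by (rewrite <- sinh_0; apply sinh_lt; lra).
  assert (0 < sqrt (1 + k ^ 2) * sinh (2 * s) / (2 * rho k s) * cosh (axial k s)).
  { apply Rmult_lt_0_compat; [apply Rdiv_lt_0_compat; nra|lra]. }
  assert (0 <= rho k s * (speed k s * sinh (axial k s)))
    by (apply Rmult_le_pos; [lra|apply Rmult_le_pos; lra]).
  assert (0 < b - a) by lra.
  nra.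
Qed.

Lemma zcoord_even (k s : R) : 0 < k -> zcoord k (- s) = zcoord k s.
Proof.
intros Hk; unfold zcoord; rewrite rho_even, axial_odd, cosh_opp by exact Hk; reflexivity.
Qed.

Lemma zcoord_abs (k s : R) : 0 < k -> zcoord k (Rabs s) = zcoord k s.
Proof.
intros Hk; unfold Rabs; destruct (Rcase_abs s); [apply zcoord_even, Hk|reflexivity].
Qed.

(** The level [z] is even and increases with [|s|], so the truncation keeps
    exactly the parameters in [[- S, S]]. *)
Lemma is_RInt_truncated (k S a b : R) : 0 < k -> 0 <= S -> a < - S -> S < b ->
  is_RInt (fun s => if Rle_dec (zcoord k s) (zcoord k S) then rad k s else 0) a b
    (2 * RInt (rad k) 0 S).
Proof.
intros Hk HS Ha Hb.
set (g := fun s => if Rle_dec (zcoord k s) (zcoord k S) then rad k s else 0).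
assert (Gin : forall s, Rabs s < S -> g s = rad k s).
{ intros s Hs; unfold g; destruct (Rle_dec (zcoord k s) (zcoord k S)) as [H|H]; [reflexivity|].
  exfalso; apply H; rewrite <- (zcoord_abs k s) by exact Hk.
  left; apply zcoord_incr; [exact Hk|split; [apply Rabs_pos|exact Hs]]. }
assert (Gout : forall s, S < Rabs s -> g s = 0).
{ intros s Hs; unfold g; destruct (Rle_dec (zcoord k s) (zcoord k S)) as [H|H]; [|reflexivity].
  exfalso; rewrite <- (zcoord_abs k s) in H by exact Hk.
  assert (A := zcoord_incr k S (Rabs s) Hk (conj HS Hs)); lra. }
assert (Z : forall u v, is_RInt (fun _ : R => 0) u v 0).
{ intros u v; evar_last; [apply (is_RInt_const u v 0)|apply Rmult_0_r]. }
assert (I1 : is_RInt g a (- S) 0).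
{ apply is_RInt_ext with (fun _ => 0).
  - rewrite Rmin_left, Rmax_right by lra; intros s Hs; symmetry; apply Gout.
    rewrite Rabs_left by lra; lra.
  - apply Z. }
assert (I3 : is_RInt g S b 0).
{ apply is_RInt_ext with (fun _ => 0).
  - rewrite Rmin_left, Rmax_right by lra; intros s Hs; symmetry; apply Gout.
    rewrite Rabs_pos_eq by lra; lra.
  - apply Z. }
assert (I2 : is_RInt g (- S) S (2 * RInt (rad k) 0 S)).
{ apply is_RInt_ext with (rad k).
  - rewrite Rmin_left, Rmax_right by lra; intros s Hs; symmetry; apply Gin.
    apply Rabs_def1; lra.
  - replace (2 * RInt (rad k) 0 S)
      with (plus (opp (RInt (rad k) 0 (- S))) (RInt (rad k) 0 S)).
    + apply (is_RInt_Chasles (rad k) (- S) 0 S).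
      * apply (is_RInt_swap (rad k)), (@RInt_correct R_CompleteNormedModule), ex_RInt_rad, Hk.
      * apply (@RInt_correct R_CompleteNormedModule), ex_RInt_rad, Hk.
    + rewrite RInt_even; [unfold plus, opp; simpl; ring|apply rad_even|].
      intros; apply ex_RInt_rad, Hk. }
replace (2 * RInt (rad k) 0 S) with (plus (plus 0 (2 * RInt (rad k) 0 S)) 0)
  by (unfold plus; simpl; ring).
apply (is_RInt_Chasles g a S b); [|exact I3].
apply (is_RInt_Chasles g a (- S) S); [exact I1|exact I2].
Qed.

Lemma truncated_area_catenoid (c S eps : R) : 0 < c -> 0 <= S ->
  1 / eps = zcoord (modulus c) S ->
  truncated_area (catenoid c) eps = 4 * PI * RInt (rad (modulus c)) 0 S.
Proof.
intros Hc HS He; assert (Hk := modulus_gt_0 c Hc).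
unfold truncated_area; rewrite He.
rewrite (RInt_ext _ (fun _ => 2 * RInt (rad (modulus c)) 0 S)).
- rewrite RInt_const; unfold scal; simpl; unfold mult; simpl; ring.
- intros t _.
  apply (@is_RInt_gen_unique R_CompleteNormedModule); try typeclasses eauto.
  intros P HP.
  apply (Filter_prod _ _ _ (fun a => a < - S) (fun b => S < b));
    [exists (- S); tauto|exists S; tauto|].
  intros a b Ha Hb; exists (2 * RInt (rad (modulus c)) 0 S); split;
    [|apply locally_singleton, HP].
  cbn [fst snd].
  apply (is_RInt_ext (fun s => if Rle_dec (zcoord (modulus c) s) (zcoord (modulus c) S)
                               then rad (modulus c) s else 0)).
  + intros s _; rewrite area_element_catenoid, catenoid_eq by exact Hc; reflexivity.
  + apply is_RInt_truncated; assumption.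
Qed.

(** * The renormalized area *)

(** Write [z = rho * cosh a] with [a] the translation at [s].  Both
    [rho - rad <= / rad] and [rad * (1 - cosh a / cosh (halfsep k))] tend to
    0, the latter because the remaining translation is of order
    [exp (- 2 s)] while [rad] is of order [exp s]. *)
Lemma is_lim_boundary (k : R) : 0 < k ->
  is_lim (fun s => rad k s - zcoord k s / cosh (halfsep k)) p_infty 0.
Proof.
intros Hk.
set (V := halfsep k); assert (CV := cosh_ge_1 V).
set (M := 4 * k * sqrt (sqrt (1 + k ^ 2))).
assert (B : forall s, 1 <= s ->
  - / rad k s <= rad k s - zcoord k s / cosh V <= M * exp (- s)).
{ intros s Hs.
  assert (Hr := rad_gt_0 k s Hk); assert (Ho := rho_gt_0 k s Hk).
  assert (Hro := rho_rad k s Hk).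
  assert (Hd := axial_ge_0 k s Hk ltac:(lra)).
  assert (Hd' := axial_le_halfsep k s Hk); fold V in Hd'.
  assert (Hg := halfsep_axial_gap k s Hk Hs); fold V in Hg.
  assert (Cd := cosh_ge_1 (axial k s)).
  assert (Cl := cosh_le _ _ (conj Hd Hd')).
  assert (Cg := cosh_gap _ _ (conj Hd Hd')).
  assert (Hu := rad_upper k s Hk ltac:(lra)).
  set (h := cosh (axial k s)) in *.
  set (l := h / cosh V).
  assert (Hl : l * cosh V = h) by (unfold l; field; lra).
  assert (Hl1 : l <= 1).
  { apply Rmult_le_reg_r with (cosh V); lra. }
  assert (Hl0 : 0 <= l).
  { apply Rmult_le_reg_r with (cosh V); lra. }
  assert (Hl2 : 1 - l <= V - axial k s).
  { apply Rmult_le_reg_r with (cosh V); lra. }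
  replace (rad k s - zcoord k s / cosh V) with (rad k s - rho k s * l)
    by (unfold l, zcoord, Rdiv; fold h; ring).
  assert (Hdiff : 0 <= rho k s - rad k s <= / rad k s).
  { split; [nra|].
    apply Rmult_le_reg_r with (rad k s); [exact Hr|].
    rewrite Rinv_l by lra; nra. }
  split.
  - assert (rho k s * l <= rho k s * 1) by (apply Rmult_le_compat_l; lra). lra.
  - apply Rle_trans with (rad k s * (1 - l)); [nra|].
    apply Rle_trans with ((sqrt (sqrt (1 + k ^ 2)) * exp s) * (4 * k * exp (- (2 * s)))).
    + apply Rmult_le_compat; lra.
    + right; unfold M; replace (- (2 * s)) with (- s + - s) by ring.
      rewrite exp_plus, exp_Ropp; field; apply Rgt_not_eq, exp_pos. }
apply (is_lim_le_le_loc (fun s => - / rad k s) (fun s => M * exp (- s))).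
- exists 1; intros s Hs; apply B; lra.
- replace (Finite 0) with (Rbar_opp 0) by (simpl; f_equal; ring).
  apply is_lim_opp, is_lim_inv_rad, Hk.
- apply is_lim_exp_opp_scal.
Qed.

Lemma is_lim_zcoord (k : R) : 0 < k -> is_lim (zcoord k) p_infty p_infty.
Proof.
intros Hk; apply is_lim_spec; intros M.
destruct (proj2 (is_lim_spec _ _ _) (is_lim_inv_rho k Hk)
           (mkposreal (/ (Rabs M + 1)) ltac:(apply Rinv_0_lt_compat; assert (A := Rabs_pos M); lra)))
  as [N HN].
exists N; intros s Hs; specialize (HN s Hs); simpl in HN.
assert (Ho := rho_gt_0 k s Hk); assert (Cd := cosh_ge_1 (axial k s)).
assert (A := Rabs_pos M); assert (A' := Rle_abs M).
rewrite Rminus_0_r, Rabs_pos_eq in HN by (left; apply Rinv_0_lt_compat, Ho).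
assert (Rabs M + 1 < rho k s) by (apply Rinv_lt_cancel; [exact Ho|exact HN]).
unfold zcoord; nra.
Qed.

Lemma zcoord_surj (k N y : R) : 0 < k -> 0 <= N -> zcoord k N < y ->
  exists S, N < S /\ zcoord k S = y.
Proof.
intros Hk HN Hy.
destruct (proj2 (is_lim_spec _ _ _) (is_lim_zcoord k Hk) y) as [N' HN'].
set (b := Rmax N N' + 1).
assert (Hb : y < zcoord k b) by (apply HN'; unfold b; assert (A := Rmax_r N N'); lra).
assert (Nb : N < b) by (unfold b; assert (A := Rmax_l N N'); lra).
destruct (IVT_gen (zcoord k) N b y) as [S [HS E]].
- intros s; apply continuity_pt_filterlim, (ex_derive_continuous (zcoord k)).
  eexists; apply is_derive_zcoord, Hk.
- rewrite Rmin_left, Rmax_right by lra; lra.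
- rewrite Rmin_left, Rmax_right in HS by lra.
  exists S; split; [|exact E].
  destruct (Req_dec S N) as [->|]; lra.
Qed.

(** The coefficient of [1 / eps] is [4 PI / cosh (halfsep k)], because the
    area is [4 PI * rad S] up to a bounded term and the level [1 / eps] of the
    cut is [cosh (halfsep k) * rad S] up to a vanishing one. *)
Lemma renormalized_catenoid (c : R) : 0 < c ->
  is_renormalized_area (catenoid c) (4 * PI * limit_excess (modulus c)).
Proof.
intros Hc; assert (Hk := modulus_gt_0 c Hc); set (k := modulus c) in *.
set (V := halfsep k); assert (CV := cosh_ge_1 V).
exists 1%nat, (fun _ => 4 * PI / cosh V).
set (G := fun S => 4 * PI * (excess k S + (rad k S - zcoord k S / cosh V))).
assert (LG : is_lim G p_infty (4 * PI * limit_excess k)).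
{ rewrite <- (Rplus_0_r (limit_excess k)).
  apply (is_lim_scal_l (fun S => excess k S + (rad k S - zcoord k S / cosh V))
           (4 * PI) p_infty (limit_excess k + 0)).
  apply is_lim_plus'; [apply is_lim_excess, Hk|apply is_lim_boundary, Hk]. }
apply filterlim_locally; intros delta.
destruct (proj2 (is_lim_spec _ _ _) LG delta) as [N HN].
set (N' := Rmax 0 N).
assert (HN' : 0 <= N') by apply Rmax_l.
assert (Zp : 0 < zcoord k N').
{ apply Rmult_lt_0_compat; [apply rho_gt_0, Hk|].
  assert (A := cosh_ge_1 (axial k N')); lra. }
assert (Hd : 0 < / zcoord k N') by (apply Rinv_0_lt_compat, Zp).
exists (mkposreal _ Hd); intros eps Heps Hpos.
unfold ball in Heps; simpl in Heps; unfold AbsRing_ball, abs, minus, plus, opp in Heps.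
simpl in Heps; rewrite Ropp_0, Rplus_0_r, Rabs_pos_eq in Heps by lra.
assert (Hy : zcoord k N' < 1 / eps).
{ unfold Rdiv; rewrite Rmult_1_l, <- (Rinv_inv (zcoord k N')).
  apply Rinv_lt_contravar; [apply Rmult_lt_0_compat|]; assumption. }
destruct (zcoord_surj k N' (1 / eps) Hk HN' Hy) as [S [HS E]].
assert (HNS : N < S) by (assert (A := Rmax_r 0 N); fold N' in A; lra).
rewrite sum_n_n, (truncated_area_catenoid c S eps Hc) by (fold k; lra).
fold k; rewrite pow_1.
replace (4 * PI * RInt (rad k) 0 S - 4 * PI / cosh V / eps) with (G S).
- apply HN, HNS.
- unfold G, excess; rewrite E; field; lra.
Qed.

(** * Uniqueness of the constant term *)

Lemma sum_pow_bound (a : nat -> R) (N : nat) :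
  exists M, 0 <= M /\ forall x, 1 <= x ->
    Rabs (sum_n_m (fun k => a k * x ^ k) 1 N) <= M * x ^ N.
Proof.
induction N as [|N [M [HM IH]]].
- exists 0; split; [lra|]; intros x _.
  rewrite sum_n_m_zero by lia; unfold zero; simpl; rewrite Rabs_R0; lra.
- exists (M + Rabs (a (S N))); split; [assert (A := Rabs_pos (a (S N))); lra|].
  intros x Hx; rewrite sum_n_Sm by lia; unfold plus; simpl plus.
  apply Rle_trans with (1 := Rabs_triang _ _).
  rewrite Rmult_plus_distr_r, Rabs_mult, (Rabs_pos_eq (x ^ S N)) by (apply pow_le; lra).
  apply Rplus_le_compat_r, Rle_trans with (1 := IH x Hx).
  apply Rmult_le_compat_l; [exact HM|apply Rle_pow; [exact Hx|lia]].
Qed.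

(** Dividing by the highest power of [x] shows that the leading
    coefficient vanishes. *)
Lemma poly_no_constant_limit (a : nat -> R) (N : nat) (l : R) :
  is_lim (fun x => sum_n_m (fun k => a k * x ^ k) 1 N) p_infty l -> l = 0.
Proof.
induction N as [|N IH]; intros L.
- assert (L0 : is_lim (fun _ => 0) p_infty l).
  { apply is_lim_ext with (2 := L); intros x; rewrite sum_n_m_zero by lia; reflexivity. }
  apply is_lim_unique in L0; rewrite Lim_const in L0; injection L0; congruence.
- assert (Ha : a (S N) = 0).
  { destruct (sum_pow_bound a N) as [M [HM B]].
    assert (Linv : is_lim (fun x => / x) p_infty 0).
    { apply (is_lim_inv (fun x => x) p_infty p_infty); [apply is_lim_id|discriminate]. }
    apply Rabs_eq_0, Rle_antisym; [|apply Rabs_pos].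
    apply (is_lim_le_loc (fun _ => Rabs (a (S N))) (fun x => (Rabs l + 1 + M) * / x) p_infty
             (Rabs (a (S N))) 0).
    - destruct (proj2 (is_lim_spec _ _ _) L (mkposreal 1 Rlt_0_1)) as [X HX].
      exists (Rmax 1 X); intros x Hx.
      assert (X1 : 1 < x) by (apply Rle_lt_trans with (2 := Hx), Rmax_l).
      assert (X2 : X < x) by (apply Rle_lt_trans with (2 := Hx), Rmax_r).
      specialize (HX x X2); simpl in HX.
      rewrite sum_n_Sm in HX by lia; unfold plus in HX; simpl plus in HX.
      specialize (B x ltac:(lra)).
      set (p := sum_n_m (fun k => a k * x ^ k) 1 N) in *.
      assert (P1 : 1 <= x ^ N) by (apply pow_R1_Rle; lra).
      apply Rmult_le_reg_r with (x ^ S N); [apply pow_lt; lra|].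
      replace ((Rabs l + 1 + M) * / x * x ^ S N) with ((Rabs l + 1 + M) * x ^ N)
        by (simpl; field; lra).
      rewrite <- (Rabs_pos_eq (x ^ S N)) at 1 by (apply pow_le; lra).
      rewrite <- Rabs_mult.
      replace (a (S N) * x ^ S N) with ((p + a (S N) * x ^ S N - l) + (l - p)) by ring.
      apply Rle_trans with (1 := Rabs_triang _ _).
      assert (T := Rabs_triang l (- p)); rewrite Rabs_Ropp in T.
      assert (HX' : Rabs (p + a (S N) * x ^ S N - l) < 1) by exact HX.
      fold (l - p) in T.
      assert (0 <= (Rabs l + 1) * (x ^ N - 1))
        by (apply Rmult_le_pos; [assert (R0 := Rabs_pos l)|]; lra).
      lra.
    - apply is_lim_const.
    - evar_last; [apply is_lim_scal_l, Linv|simpl; f_equal; ring]. }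
  apply IH, is_lim_ext with (2 := L); intros x.
  rewrite sum_n_Sm by lia; rewrite Ha, Rmult_0_l; apply Rplus_0_r.
Qed.

Lemma sum_pad (a : nat -> R) (N L : nat) (x : R) : (N <= L)%nat ->
  sum_n_m (fun k => a k * x ^ k) 1 N
  = sum_n_m (fun k => (if Nat.leb k N then a k else 0) * x ^ k) 1 L.
Proof.
intros HL; induction HL as [|L HL IH].
- apply sum_n_m_ext_loc; intros k Hk.
  rewrite (proj2 (Nat.leb_le k N)) by lia; reflexivity.
- rewrite sum_n_Sm, <- IH by lia.
  rewrite (proj2 (Nat.leb_gt (S L) N)) by lia.
  rewrite Rmult_0_l; symmetry; apply Rplus_0_r.
Qed.

(** The difference of two expansions of the same area is a polynomial in
    [1 / eps] without constant term, after padding to a common degree. *)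
Lemma renormalized_unique (X : R -> R -> R4) (A B : R) :
  is_renormalized_area X A -> is_renormalized_area X B -> A = B.
Proof.
intros [N [a HA]] [M [b HB]].
assert (Linv : filterlim (fun x => / x) (Rbar_locally p_infty) (at_right 0)).
{ intros P [d HP].
  exists (/ d); intros x Hx.
  assert (Hd := cond_pos d).
  assert (Hx0 : 0 < x) by (apply Rlt_trans with (2 := Hx), Rinv_0_lt_compat, Hd).
  assert (Hi : 0 < / x) by (apply Rinv_0_lt_compat, Hx0).
  apply HP; [|exact Hi].
  unfold ball; simpl; unfold AbsRing_ball, abs, minus, plus, opp; simpl.
  rewrite Ropp_0, Rplus_0_r, Rabs_pos_eq by lra.
  rewrite <- (Rinv_inv d); apply Rinv_lt_contravar; [|exact Hx].
  apply Rmult_lt_0_compat; [apply Rinv_0_lt_compat, Hd|exact Hx0]. }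
assert (LA := filterlim_comp _ _ _ _ _ _ _ _ Linv HA).
assert (LB := filterlim_comp _ _ _ _ _ _ _ _ Linv HB).
assert (L := is_lim_minus' _ _ p_infty A B LA LB).
cbv beta in L.
apply Rminus_diag_uniq.
apply (poly_no_constant_limit
  (fun k => (if Nat.leb k M then b k else 0) - (if Nat.leb k N then a k else 0)) (Nat.max N M)).
apply is_lim_ext with (2 := L); intros x.
assert (P : forall (f : nat -> R) n, sum_n_m (fun k => f k / (/ x) ^ k) 1 n
                          = sum_n_m (fun k => f k * x ^ k) 1 n).
{ intros f n; apply sum_n_m_ext; intros k.
  rewrite pow_inv; unfold Rdiv; rewrite Rinv_inv; reflexivity. }
rewrite !P, (sum_pad a N (Nat.max N M)), (sum_pad b M (Nat.max N M)) by lia.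
set (f := fun k => (if Nat.leb k N then a k else 0) * x ^ k).
set (g := fun k => (if Nat.leb k M then b k else 0) * x ^ k).
transitivity (sum_n_m (fun k => plus (g k) (opp (f k))) 1 (Nat.max N M)).
2:{ apply sum_n_m_ext; intros k; symmetry; apply Rmult_minus_distr_r. }
rewrite (sum_n_m_plus g (fun k => opp (f k))).
assert (So : forall n, sum_n_m (fun k => opp (f k)) 1 n = opp (sum_n_m f 1 n)).
{ intros n; induction n as [|n IHn].
  - rewrite !sum_n_m_zero by lia; unfold zero, opp; simpl; ring.
  - rewrite !sum_n_Sm, IHn by lia; unfold plus, opp; simpl; ring. }
rewrite So.
change (truncated_area X (/ x) - sum_n_m f 1 (Nat.max N M)
        - (truncated_area X (/ x) - sum_n_m g 1 (Nat.max N M))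
        = sum_n_m g 1 (Nat.max N M) + - sum_n_m f 1 (Nat.max N M)).
ring.
Qed.

(** * The maximum *)

Lemma renormalized_area_catenoid (c : R) : 0 < c ->
  renormalized_area (catenoid c) = 4 * PI * limit_excess (modulus c).
Proof.
intros Hc; apply (@iota_unique R_AbsRing R_CompleteNormedModule);
  [|apply renormalized_catenoid, Hc].
intros A HA; apply (renormalized_unique (catenoid c)); [exact HA|].
apply renormalized_catenoid, Hc.
Qed.

Theorem corollary4p3 :
  (forall c : R, 0 < c ->
     is_renormalized_area (catenoid c) (renormalized_area (catenoid c)))
  /\
  exists c0 : R, 0 < c0
    /\ (forall c : R, 0 < c -> c <> c0 -> height c < height c0)
    /\ (forall c : R, 0 < c ->
          renormalized_area (catenoid c) <= renormalized_area (catenoid c0)).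
Proof.
split.
{ intros c Hc; rewrite renormalized_area_catenoid by exact Hc.
  apply renormalized_catenoid, Hc. }
destruct slope_sign_change as [k0 [H0 [Hl Hr]]].
set (c0 := sqrt (2 / k0)).
assert (Hc0 : 0 < c0) by (apply sqrt_lt_R0, Rdiv_lt_0_compat; lra).
assert (E0 : modulus c0 = k0).
{ unfold modulus, c0; rewrite pow2_sqrt by (left; apply Rdiv_lt_0_compat; lra).
  field; lra. }
exists c0; split; [exact Hc0|split].
- intros c Hc Hne; rewrite !height_catenoid, E0 by assumption.
  apply tanh_lt, halfsep_max; try assumption; [apply modulus_gt_0, Hc|].
  intros E; apply Hne.
  unfold c0; rewrite <- E; unfold modulus.
  replace (2 / (2 / c ^ 2)) with (c ^ 2) by (field; lra).
  symmetry; apply sqrt_pow2; lra.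
- intros c Hc; rewrite !renormalized_area_catenoid, E0 by assumption.
  assert (HP := PI_RGT_0).
  apply Rmult_le_compat_l; [lra|].
  assert (Hk := modulus_gt_0 c Hc).
  destruct (Rtotal_order (modulus c) k0) as [Hlt|[->|Hgt]]; [|apply Rle_refl|].
  + apply (limit_excess_mono (modulus c) k0); [lra|].
    intros k Hk'; left; apply Hl; lra.
  + apply (limit_excess_mono k0 (modulus c)); [lra|].
    intros k Hk'; left; apply Hr; lra.
Qed.
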